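(* Let $X$ be a Hausdorff topological space, $W$ a real Banach space with a continuous inclusion $X\subset W'$, $F:X\to W'$ a Borel map, and $\{S(t)\}_{t\ge0}$ a continuous semigroup on $X$ associated with the equation $du/dt=F(u)$. Let $B\subset X$ be a nonempty positively invariant set for $\{S(t)\}_{t\geq 0}$ which is closed in $X$ and is a normal topological space with the topology inherited from $X$. Suppose there exists a compact and metrizable subset $K$ of $X$ which attracts the points of $B$. Suppose $F$ is continuous on $K$. Let $\phi\in\mathcal{C}_b(B)$. Then $$\max_{\mu\in\mathcal{P}_{\mathrm{wsss}}(B\cap K)}\int_{B\cap K}\phi(u)\,d\mu(u)=\inf_{\Psi\in\mathcal{T}^{\mathrm{cyl}}(W')}\ \max_{u\in B\cap K}\left\{\phi(u)+\langle F(u),\Psi'(u)\rangle_{W',W}\right\}.$$ Suppose, further, that $\mathcal{P}_{\mathrm{wsss}}(B\cap K)=\mathcal{P}_{\mathrm{inv}}(B\cap K)$. Then $$\max_{u_0\in B}\ \limsup_{T\to\infty}\frac1T\int_0^T\phi(S(t)u_0)\,dt=\inf_{\Psi\in\mathcal{T}^{\mathrm{cyl}}(W')}\ \max_{u\in B\cap K}\left\{\phi(u)+\langle F(u),\Psi'(u)\rangle_{W',W}\right\}.$$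
   Context: $W'$ is the dual of $W$ with the dual norm, and $\langle\cdot,\cdot\rangle_{W',W}$ is the duality product. $\mathcal{C}_b(B)$ is the space of bounded continuous real-valued functions on $B$. Continuous semigroup on $X$: a family $\{S(t)\}_{t\ge0}$ of maps $X\to X$ such that $(t,u)\mapsto S(t)u$ is continuous from $[0,\infty)\times X$ to $X$, $S(0)$ is the identity, and $S(t+s)=S(t)S(s)$ for all $t,s\ge0$. It is associated with $du/dt=F(u)$ if for every $u_0\in X$ and $w\in W$, with $u(t)=S(t)u_0$, the function $t\mapsto\langle u(t),w\rangle_{W',W}$ is continuously differentiable on $[0,\infty)$ and $\frac{d}{dt}\langle u(t),w\rangle_{W',W}=\langle F(u(t)),w\rangle_{W',W}$ for all $t\ge0$. $B$ is positively invariant if $S(t)u_0\in B$ for all $t\ge0$, $u_0\in B$. A set $A\subset X$ attracts the points of $B$ if for each $u_0\in B$ and every open neighborhood $O$ of $A$ there is $T>0$ with $S(t)u_0\in O$ for all $t\ge T$ (no uniformity in $u_0$). Cylindrical test functionals: $\mathcal{T}^{\mathrm{cyl}}(W')$ is the set of functions $\Psi:W'\to\mathbb{R}$ of the form $\Psi(u)=\psi(\langle u,w_1\rangle_{W',W},\ldots,\langle u,w_m\rangle_{W',W})$, with $m\in\mathbb{N}$, $w_1,\ldots,w_m\in W$ and $\psi\in\mathcal{C}^1_c(\mathbb{R}^m)$ (compactly supported, continuously differentiable, real-valued). Its derivative is $\Psi'(u)=\sum_{j=1}^m\partial_j\psi(\langle u,w_1\rangle_{W',W},\ldots,\langle u,w_m\rangle_{W',W})\,w_j\in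 W$. Weak stationary statistical solution of $du/dt=F(u)$: a Borel probability measure $\mu$ on $X$ such that, for every $\Psi\in\mathcal{T}^{\mathrm{cyl}}(W')$, the map $u\mapsto\langle F(u),\Psi'(u)\rangle_{W',W}$ is $\mu$-integrable and $\int_X\langle F(v),\Psi'(v)\rangle_{W',W}\,d\mu(v)=0$. Invariant measure: a Borel probability measure $\mu$ on $X$ with $\mu(S(t)^{-1}E)=\mu(E)$ for all Borel $E\subset X$ and $t\ge0$. For a Borel set $E\subset X$, $\mathcal{P}_{\mathrm{wsss}}(E)$ and $\mathcal{P}_{\mathrm{inv}}(E)$ are the sets of weak stationary statistical solutions, respectively invariant measures, carried by $E$, i.e. with $\mu(X\setminus E)=0$. *)

(* Defs.v *)
From HB Require Import structures.
From mathcomp Require Import all_boot all_order all_algebra.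
From mathcomp Require Import all_classical all_reals all_analysis.

Set Implicit Arguments.
Unset Strict Implicit.
Unset Printing Implicit Defensive.

Import Order.TTheory GRing.Theory Num.Theory.
Import numFieldNormedType.Exports.

Local Open Scope classical_set_scope.
Local Open Scope ring_scope.

Section dual.
Context {R : realType} {W : normedModType R}.

Definition dual_pred : {pred W -> R^o} :=
  [pred f | `[< linear f /\ continuous f >]].

Lemma dual_submod_closed : submod_closed dual_pred.
Proof.
split.
  apply/asboolP; split; last by move=> x; exact: cvg_cst.
  by move=> a x y; rewrite -[0 _]/0 scaler0 addr0.
move=> a f g /asboolP[lf cf] /asboolP[lg cg]; apply/asboolP; split.
  move=> b x y.
  rewrite -[LHS]/(a *: f (b *: x + y) + g (b *: x + y)).
  rewrite -[RHS]/(b *: (a *: f x + g x) + (a *: f y + g y)).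
  by rewrite lf lg !scalerDr !scalerA (mulrC a b) addrACA.
move=> x; rewrite -[a *: f + g]/(fun x => a *: f x + g x).
by apply: cvgD; [apply: cvgZr; exact: cf|exact: cg].
Qed.

HB.instance Definition _ :=
  GRing.isSubmodClosed.Build R (W -> R^o) dual_pred dual_submod_closed.

End dual.

Record dual (R : realType) (W : normedModType R) := Dual {
  dual_val :> W -> R^o;
  dual_valP : dual_val \in dual_pred }.

Section dual_normed.
Context {R : realType} {W : normedModType R}.

HB.instance Definition _ := [isSub for @dual_val R W].
HB.instance Definition _ := [Choice of dual W by <:].
HB.instance Definition _ := [SubChoice_isSubLmodule of dual W by <:].

Lemma dualE_linear (f : dual W) : linear (f : W -> R^o).
Proof. by case: f => f /= /asboolP[]. Qed.

Lemma dual_continuous (f : dual W) : continuous (f : W -> R^o).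
Proof. by case: f => f /= /asboolP[]. Qed.

HB.instance Definition _ (f : dual W) :=
  GRing.isLinear.Build R W R^o _ (f : W -> R^o) (dualE_linear f).

Definition dual_norm (f : dual W) : R :=
  sup [set `|f w| | w in [set w : W | `|w| <= 1]].

Lemma dual_has_sup (f : dual W) :
  has_sup [set `|f w| | w in [set w : W | `|w| <= 1]].
Proof.
split; first by exists `|f 0|, 0 => //=; rewrite normr0.
have /linear_bounded_continuous/linear_boundedP := @dual_continuous f.
move=> /pinfty_ex_gt0[M M0 fM]; exists M => _ [w /= w1 <-].
by rewrite (le_trans (fM w))// ler_piMr// ltW.
Qed.

Lemma dual_norm_ub (f : dual W) (w : W) : `|w| <= 1 -> `|f w| <= dual_norm f.
Proof.
by move=> w1; apply: ub_le_sup; [exact: (dual_has_sup f).2|exists w].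
Qed.

Lemma dual_norm_ge0 (f : dual W) : 0 <= dual_norm f.
Proof. by rewrite (le_trans _ (@dual_norm_ub f 0 _)) ?normr0. Qed.

Lemma dual_norm_le (f : dual W) (M : R) :
  (forall w : W, `|w| <= 1 -> `|f w| <= M) -> dual_norm f <= M.
Proof.
move=> fM; apply: ge_sup; first exact: (dual_has_sup f).1.
by move=> _ [w /= w1 <-]; exact: fM.
Qed.

Lemma dual_ler_normD (f g : dual W) :
  dual_norm (f + g) <= dual_norm f + dual_norm g.
Proof.
apply: dual_norm_le => w w1; rewrite -[(f + g) w]/(f w + g w).
by rewrite (le_trans (ler_normD _ _))// lerD// dual_norm_ub.
Qed.

Lemma dual_normZ_le (a : R) (f : dual W) :
  dual_norm (a *: f) <= `|a| * dual_norm f.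
Proof.
apply: dual_norm_le => w w1; rewrite -[(a *: f) w]/(a * f w) normrM.
by rewrite ler_wpM2l// dual_norm_ub.
Qed.

Lemma dual_normrZ (a : R) (f : dual W) : dual_norm (a *: f) = `|a| * dual_norm f.
Proof.
apply/eqP; rewrite eq_le dual_normZ_le/=.
have [->|a0] := eqVneq a 0; first by rewrite normr0 mul0r dual_norm_ge0.
rewrite -ler_pdivlMl ?normr_gt0//.
rewrite -{1}[f]scale1r -(mulVf a0) -scalerA -normfV.
exact: dual_normZ_le.
Qed.

Lemma dual_normr0_eq0 (f : dual W) : dual_norm f = 0 -> f = 0.
Proof.
move=> f0; apply/val_inj/funext => w /=; rewrite -[RHS]/(0 : R).
have [->|w0] := eqVneq w 0; first by rewrite -[dual_val f]/(f : W -> R^o) linear0.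
have : `|f (`|w|^-1 *: w)| <= dual_norm f.
  by apply: dual_norm_ub; rewrite normrZ normfV normr_id mulVf// normr_eq0.
rewrite f0 normr_le0 linearZ/= => /eqP/eqP.
by rewrite scaler_eq0 invr_eq0 normr_eq0 (negbTE w0)/= => /eqP.
Qed.

HB.instance Definition _ := @Lmodule_isNormed.Build R (dual W) dual_norm
  dual_ler_normD dual_normrZ dual_normr0_eq0.

End dual_normed.

Definition C1c (R : realType) (m : nat) (psi : 'rV[R]_m -> R) : Prop :=
  [/\ forall x, differentiable psi x,
      forall j : 'I_m, continuous (fun x => 'D_(delta_mx 0 j) psi x) &
      compact (closure [set x | psi x != 0])].

(* A functional u |-> psi(<u,w_1>, ..., <u,w_m>) is recorded together with a
   presentation (m, w, psi). The pairing of its derivative with any element of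
   the dual depends on the underlying function only: see cyl_derivE. *)
Record cyl (R : realType) (W : normedModType R) := Cyl {
  cyl_dim : nat;
  cyl_dir : 'I_cyl_dim -> W;
  cyl_prof : 'rV[R]_cyl_dim -> R;
  cyl_profP : C1c cyl_prof }.

Section cyl.
Context {R : realType} {W : normedModType R}.
Implicit Types (Psi : cyl W) (u v : dual W).

Definition cyl_coord Psi u : 'rV[R]_(cyl_dim Psi) := \row_j u (cyl_dir j).

Definition cyl_fun Psi u : R := cyl_prof (cyl_coord Psi u).

Definition cyl_deriv Psi u : W :=
  \sum_j 'D_(delta_mx 0 j) (@cyl_prof _ _ Psi) (cyl_coord Psi u) *: cyl_dir j.

Lemma cyl_derivE Psi u v : 'D_v (cyl_fun Psi) u = v (cyl_deriv Psi u).
Proof.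
have [dpsi _ _] := cyl_profP Psi.
transitivity ('D_(cyl_coord Psi v) (@cyl_prof _ _ Psi) (cyl_coord Psi u)).
  have coordE (h : R) : cyl_fun Psi (h *: v + u) =
      cyl_prof (h *: cyl_coord Psi v + cyl_coord Psi u).
    by congr (cyl_prof _); apply/rowP => i; rewrite !mxE.
  by rewrite /derive /shift/=; under eq_fun do rewrite coordE.
rewrite deriveE// [X in 'd _ _ X]row_sum_delta linear_sum/=.
rewrite /cyl_deriv (linear_sum (v : {linear W -> R^o}))/=.
apply: eq_bigr => j _.
rewrite linearZ/= (linearZ_LR (v : {linear W -> R^o}))/= deriveE//.
by rewrite mxE [LHS]mulrC.
Qed.

End cyl.

(* Measurable types of the library are pointed, hence the use of pointed
   topological spaces for carriers of Borel measures. *)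
Notation borel T := (g_sigma_algebraType (@open T)).

Definition metrizable (R : realType) (T : topologicalType) : Prop :=
  exists d : T -> T -> R,
    [/\ forall x y, 0 <= d x y,
        forall x y, d x y = 0 <-> x = y,
        forall x y, d x y = d y x,
        forall x y z, d x z <= d x y + d y z &
        forall U : set T, open U <->
          forall x, U x -> exists2 e : R, 0 < e & [set y | d x y < e] `<=` U].

Section order_extrema.
Context {d : Order.disp_t} {T : porderType d}.

Definition is_max (A : set T) (m : T) : Prop := A m /\ ubound A m.

Definition is_inf (A : set T) (m : T) : Prop := infimums A m.

End order_extrema.

(* The quotients are taken within [0, +oo[, so that the derivative at 0 is
   one-sided. *)
Definition C1_nonneg (R : realType) (g dg : R -> R) : Prop :=
  (forall t, 0 <= t ->
    (fun s => (s - t)^-1 * (g s - g t)) @ within `[0, +oo[ t^' --> dg t) /\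
  {within `[0, +oo[, continuous dg}.

Section semigroups.
Context {R : realType} {X : topologicalType}.
Implicit Type S : R -> X -> X.

Definition continuous_semigroup S : Prop :=
  [/\ {within `[0, +oo[ `*` [set: X],
         continuous (fun tu : R * X => S tu.1 tu.2)},
      forall u, S 0 u = u &
      forall t s u, 0 <= t -> 0 <= s -> S (t + s) u = S t (S s u)].

(* iota is the inclusion of X in the dual of W. *)
Definition associated_semigroup (W : normedModType R) (iota F : X -> dual W) S
    : Prop :=
  forall (u0 : X) (w : W),
    C1_nonneg (fun t => iota (S t u0) w) (fun t => F (S t u0) w).

Definition positively_invariant S (B : set X) : Prop :=
  forall t u0, 0 <= t -> B u0 -> B (S t u0).

Definition attracts_points S (A B : set X) : Prop :=
  forall u0, B u0 -> forall O : set X, open O -> A `<=` O ->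
    exists2 T : R, 0 < T & forall t, T <= t -> O (S t u0).

End semigroups.

Section statistical_solutions.
Context {R : realType} {X : ptopologicalType} {W : normedModType R}.
Variables (iota F : X -> dual W) (S : R -> X -> X).
Implicit Types (mu : probability (borel X) R) (E : set X) (phi : X -> R).

Definition weak_stationary mu : Prop :=
  forall Psi : cyl W,
    mu.-integrable [set: borel X]
      (fun v : borel X => (F v (cyl_deriv Psi (iota v)))%:E) /\
    (\int[mu]_v (F v (cyl_deriv Psi (iota v)))%:E = 0)%E.

Definition invariant_measure mu : Prop :=
  forall (t : R) (E : set (borel X)), 0 <= t -> measurable E ->
    mu (S t @^-1` E) = mu E.

Definition carried_by E mu : Prop := mu (~` E) = 0%E.

Definition P_wsss E : set (probability (borel X) R) :=
  [set mu | weak_stationary mu /\ carried_by E mu].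

Definition P_inv E : set (probability (borel X) R) :=
  [set mu | invariant_measure mu /\ carried_by E mu].

(* Functions on a subset B of X, such as phi in C_b(B), are represented by total
   functions on X whose values outside B are irrelevant. *)
Definition limsup_time_average phi (u0 : X) : \bar R :=
  limf_esup
    (fun T : R =>
       (T^-1 * \int[lebesgue_measure]_(t in `[0, T]) phi (S t u0))%:E)
    +oo%R.

Definition lagrangian phi (Psi : cyl W) (u : X) : R :=
  phi u + F u (cyl_deriv Psi (iota u)).

End statistical_solutions.

(* Main.v *)
(* Omega-limit sets provide a full forward trajectory inside L = B `&` K, along
   which a bounded test functional Psi cannot decrease at a linear rate; hence
   max_L <F, Psi'> >= 0 for every Psi. The duality is then Hahn-Banach: the
   pairs (a, f) such that f + <F, Psi'> <= a on L for some Psi form a convex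
   cone, and the linear functionals below it are the stationary measures.
   Functionals become measures through the Cantor space C, which maps onto the
   compact metrizable set L: a functional on all bounded functions on C,
   restricted to indicators of clopen sets, is a finitely additive set function,
   and compactness makes it countably additive.
   The same argument, for the cone of pairs (a, f) such that f <= g on L for
   some g in C_b(B) whose time averages along a trajectory are eventually at
   most a + e for all e > 0, produces an invariant measure, so that no upper time
   average exceeds the maximum. Conversely, by the reverse Fatou lemma, some
   point of L has an upper time average at least the integral of phi against a
   maximizing invariant measure. *)
From HB Require Import structures.
Require Import Defs.
From mathcomp Require Import all_boot all_order all_algebra.
From mathcomp Require Import all_classical all_reals all_analysis.
From mathcomp Require Import measurable_realfun.
From mathcomp Require Import ring lra.

Set Implicit Arguments.
Unset Strict Implicit.
Unset Printing Implicit Defensive.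

Import Order.TTheory GRing.Theory Num.Theory.
Import numFieldNormedType.Exports.

Local Open Scope classical_set_scope.
Local Open Scope ring_scope.

(** * Hahn-Banach for convex cones *)

(** Two obstacles shape the proof. First, [L] need not be positively invariant: [S t] may carry its
    points out of [K], though not out of [B]. Invariance of a measure carried by [L] is therefore
    tested on bounded functions continuous on [B], and normality of [B] provides enough of them to
    determine the values on open sets. The majorants g in the cone of time averages live on [B] for
    a similar reason: a trajectory approaches [L] without having to enter it. Second, the bounds to
    be dualized are infima that need not be attained, and may be infinite on unbounded functions.
    They are handled through the sets of admissible pairs (a, f) rather than as sublinear functions.
    When [v] is the infimum at a given f, adjoining (- v, - f) before passing to a maximal cone
    forces the functional to take the value [v] there; this is what makes a maximum over measures
    attained. The functions in the cones live on the Cantor space and need not factor through the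
    map onto [L], so that clopen indicators are among them. *)

Section hahn_banach_cone.
Context {R : realType} {V : lmodType R}.
Implicit Types (E M : set (R * V)) (f g : V).

(** [E (a, f)] stands for p(f) <= a with p sublinear; the relation spares asking that the infimum of
    such [a] be finite or attained. The last condition says that p(0) is not negative. *)
Definition proper_cone E : Prop :=
  [/\ E (0, 0),
      forall a f b g, E (a, f) -> E (b, g) -> E (a + b, f + g),
      forall t a f, 0 < t -> E (a, f) -> E (t * a, t *: f) &
      forall a, E (a, 0) -> 0 <= a].

(** The vectors with p(f) and p(- f) below +oo. In a proper cone both values are then finite, since
    p(f) + p(- f) >= p(0) >= 0. *)
Definition two_sided E : set V :=
  [set f | (exists a, E (a, f)) /\ (exists b, E (b, - f))].

(** Adjoining (- v, - f) imposes the lower bound [v] on the value at [f]. A new pair over 0 is (a -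
    t v, 0) with (a, t f) in [E], and for t > 0 homogeneity gives a / t >= v. *)
Lemma proper_cone_extend E f v : proper_cone E ->
  (forall a, E (a, f) -> v <= a) ->
  exists2 M, proper_cone M & E `<=` M /\ M (- v, - f).
Proof.
move=> [E0 Eadd Escale Epos] vf.
exists [set x | exists t a g, [/\ 0 <= t, E (a, g), x.1 = a - t * v & x.2 = g - t *: f]].
  split.
  - by exists 0, 0, 0; split => //=; rewrite ?mul0r ?scale0r subr0.
  - move=> a g b h /= [t [a' [g' [t0 Eg -> ->]]]] [s [b' [h' [s0 Eh -> ->]]]].
    exists (t + s), (a' + b'), (g' + h'); split => //; first exact: addr_ge0.
    + exact: Eadd.
    + by rewrite mulrDl opprD addrACA.
    + by rewrite scalerDl opprD addrACA.
  - move=> s a g s0 /= [t [a' [g' [t0 Eg -> ->]]]].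
    exists (s * t), (s * a'), (s *: g'); split => //.
    + by rewrite mulr_ge0// ltW.
    + exact: Escale.
    + by rewrite mulrBr mulrA.
    + by rewrite scalerBr scalerA.
  - move=> _ /= [t [a [g [t0 Eg -> /esym/eqP]]]].
    rewrite subr_eq0 => /eqP gE; rewrite subr_ge0.
    move: t0; rewrite le_eqVlt => /orP[/eqP t0|t0].
      by move: Eg; rewrite gE -t0 scale0r mul0r => /Epos.
    rewrite mulrC -ler_pdivlMr//; apply: vf.
    have := Escale t^-1 a g; rewrite invr_gt0 => /(_ t0 Eg).
    by rewrite gE scalerA mulVf ?gt_eqF// scale1r mulrC.
split.
  move=> [a g] Eg; exists 0, a, g; split => //=;
  by rewrite ?mul0r ?scale0r subr0.
by exists 1, 0, 0; split => //=; rewrite ?mul1r ?scale1r sub0r.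
Qed.

Lemma proper_cone_maximal E : proper_cone E ->
  exists2 M, proper_cone M & E `<=` M /\
    forall N, proper_cone N -> M `<=` N -> N `<=` M.
Proof.
move=> coneE.
(* Zorn's lemma is applied to the sets that become proper cones after adjoining [E], so that the
   union of the empty chain qualifies. *)
have [] := @Zorn_bigcup _ [set A | proper_cone (E `|` A)].
  move=> F FP Ftot /=.
  have in2 x y : (E `|` \bigcup_(A in F) A) x -> (E `|` \bigcup_(A in F) A) y ->
      exists A, [/\ proper_cone A, A `<=` E `|` \bigcup_(A in F) A, A x & A y].
    have UF A : F A -> E `|` A `<=` E `|` \bigcup_(A in F) A.
      by move=> FA; apply: setUS; apply: bigcup_sup.
    move=> [Ex|[A FA Ax]] [Ey|[B FB By]].
    - by exists E; split => //; exact: subsetUl.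
    - by exists (E `|` B); split; [exact: FP|exact: UF|left|right].
    - by exists (E `|` A); split; [exact: FP|exact: UF|right|left].
    - have [AB|BA] := Ftot _ _ FA FB.
        exists (E `|` B); split; [exact: FP|exact: UF| |by right].
        by right; exact: AB.
      exists (E `|` A); split; [exact: FP|exact: UF|by right|].
      by right; exact: BA.
  split.
  - by left; case: coneE.
  - move=> a f b g Ef Eg; have [A [[_ addA _ _] AU Af Ag]] := in2 _ _ Ef Eg.
    exact/AU/addA.
  - move=> t a f t0 Ef; have [A [[_ _ scA _] AU Af _]] := in2 _ _ Ef Ef.
    exact/AU/scA.
  - by move=> a Ef; have [A [[_ _ _ posA] AU Af _]] := in2 _ _ Ef Ef; exact: posA.
move=> A [coneA Amax]; exists (E `|` A) => //; split; first exact: subsetUl.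
move=> N coneN AN; apply: contrapT => NA.
apply: (Amax N); last first.
  rewrite /=; suff -> : E `|` N = N by [].
  by apply/setUidPr => x Ex; apply: AN; left.
split; first by move=> x Ax; apply: AN; right.
by apply: contra_not NA => NA; apply: subset_trans NA _; exact: subsetUr.
Qed.

(* In a maximal cone M, the two infima of [a] over M(a, f) and M(a, -f) are
   attained and opposite, which makes the infimum linear in f. *)
Lemma cone_functional E f0 v : proper_cone E -> two_sided E f0 ->
  infimums [set a | E (a, f0)] v ->
  exists Lam : V -> R,
    [/\ Lam f0 = v,
        forall f g, two_sided E f -> two_sided E g ->
          Lam (f + g) = Lam f + Lam g,
        forall t f, two_sided E f -> Lam (t *: f) = t * Lam f &
        forall f a, two_sided E f -> E (a, f) -> Lam f <= a].
Proof.
move=> coneE Df0 [lbv glbv].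
(* This pair forces [Lam f0 >= v]; the reverse inequality will come from [v] being the greatest
   lower bound. *)
have [E1 coneE1 [EE1 E1v]] := proper_cone_extend coneE lbv.
have [M coneM [E1M Mmax]] := proper_cone_maximal coneE1.
have EM := subset_trans EE1 E1M.
have [M0 Madd Mscale Mpos] := coneM.
have MP a b f : M (a, f) -> M (b, - f) -> - b <= a.
  move=> Mf /(Madd _ _ _ _ Mf); rewrite subrr => /Mpos; lra.
have attained f a b : M (a, f) -> M (b, - f) ->
    exists l, [/\ M (- l, - f), forall c, M (c, f) -> l <= c &
      forall c, (forall a, M (a, f) -> c <= a) -> c <= l].
  move=> Mf Mf'; pose l := inf [set c | M (c, f)].
  have hinf : has_inf [set c | M (c, f)].
    by split; [exists a|exists (- b) => c /MP; exact].
  have lP c : M (c, f) -> l <= c by move=> Mc; apply: ge_inf => //; case: hinf.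
  exists l; split => //; last first.
    by move=> c cP; apply: lb_le_inf; [exists a|move=> d /cP].
  (* The pair (- l, - f) can be adjoined to [M], hence belongs to it by maximality. *)
  have [N coneN [MN Nl]] := proper_cone_extend coneM lP.
  exact: (Mmax N).
have ex f : two_sided E f -> exists l, M (l, f) /\ M (- l, - f).
  move=> [[a /EM Mf] [b /EM Mf']].
  have [l [Ml lP lglb]] := attained _ _ _ Mf Mf'.
  have Mf2 : M (a, - - f) by rewrite opprK.
  have [k [Mk kP kglb]] := attained _ _ _ Mf' Mf2.
  move: Mk; rewrite opprK => Mk.
  suff kl : l = - k by exists l; split => //; rewrite kl.
  apply/eqP; rewrite eq_le lP//= lerNl; apply: kglb => c Mc.
  by rewrite lerNl; apply: lglb => d Md; exact: MP Md Mc.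
have uniq f l k : M (l, f) -> M (- l, - f) -> M (k, f) -> M (- k, - f) -> l = k.
  move=> Ml Ml' Mk Mk'; have := MP _ _ _ Mk Ml'; have := MP _ _ _ Ml Mk'.
  by rewrite !opprK => kl lk; apply/eqP; rewrite eq_le kl lk.
have /choice[Lam LamP] : forall f, exists l,
    two_sided E f -> M (l, f) /\ M (- l, - f).
  move=> f; have [/ex[l]|nD] := pselect (two_sided E f); first by exists l.
  by exists 0.
have Escale : forall t a f, 0 < t -> E (a, f) -> E (t * a, t *: f).
  by case: coneE.
have DN f : two_sided E f -> two_sided E (- f).
  by move=> [? ?]; split => //; rewrite opprK.
have DD f g : two_sided E f -> two_sided E g -> two_sided E (f + g).
  case: coneE => _ Eadd _ _ [[a Ea] [b Eb]] [[c Ec] [d Ed]]; split.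
    by exists (a + c); exact: Eadd.
  by exists (b + d); rewrite opprD; exact: Eadd.
have LamN f : two_sided E f -> Lam (- f) = - Lam f.
  move=> Df; have [m1 m2] := LamP _ Df; have [m3 m4] := LamP _ (DN _ Df).
  by apply: (uniq (- f)) => //; rewrite opprK in m4 *; rewrite opprK.
have Dpos t f : 0 < t -> two_sided E f -> two_sided E (t *: f).
  move=> t0 [[a Ea] [b Eb]]; split; first by exists (t * a); exact: Escale.
  by exists (t * b); rewrite -scalerN; exact: Escale.
have Lampos t f : 0 < t -> two_sided E f -> Lam (t *: f) = t * Lam f.
  move=> t0 Df; have Dt := Dpos _ _ t0 Df.
  have [m1 m2] := LamP _ Df; have [m3 m4] := LamP _ Dt.
  apply: (uniq (t *: f)) => //; first exact: Mscale.
  by rewrite -mulrN -scalerN; exact: Mscale.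
have E00 : two_sided E 0.
  by case: coneE => ? _ _ _; split; exists 0; rewrite ?oppr0.
have Lam0 : Lam 0 = 0.
  by have [m1 m2] := LamP _ E00; apply: (uniq 0) => //; rewrite !oppr0.
exists Lam; split.
- have [m1 m2] := LamP _ Df0; apply/eqP; rewrite eq_le.
  have M1 := E1M _ E1v.
  have := MP _ _ _ m1 M1; rewrite opprK => ->; rewrite andbT.
  by apply: glbv => a /= /EM Ma; have := MP _ _ _ Ma m2; rewrite opprK.
- move=> f g Df Dg; have [m1 m2] := LamP _ Df; have [m3 m4] := LamP _ Dg.
  have [m5 m6] := LamP _ (DD _ _ Df Dg).
  apply: (uniq (f + g)) => //; first exact: Madd.
  by rewrite !opprD; exact: Madd.
- move=> t f Df; have [t0|t0|<-] := ltgtP 0 t; first exact: Lampos.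
    by rewrite -[t]opprK scaleNr LamN ?Lampos ?mulNr ?oppr_gt0//;
      apply: Dpos; rewrite ?oppr_gt0.
  by rewrite scale0r mul0r.
- move=> f a Df /EM Ma; have [m1 m2] := LamP _ Df.
  by have := MP _ _ _ Ma m2; rewrite opprK.
Qed.

End hahn_banach_cone.

(** * Measures on the Cantor space *)

(** Were [P A] false, the sets whose complement in [A] satisfies [P] would form a proper filter
    containing [A], and a cluster point in [A] would contradict the local hypothesis. This induction
    stands in for the extraction of finite subcovers. *)
Lemma compact_local_ind (T : topologicalType) (A : set T) (P : set T -> Prop) :
  compact A -> P set0 -> (forall B C, B `<=` C -> P C -> P B) ->
  (forall B C, P B -> P C -> P (B `|` C)) ->
  (forall x, A x -> exists2 U, nbhs x U & P U) -> P A.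
Proof.
move=> cA P0 Psub PU Ploc; apply: contrapT => nPA.
pose F : set_system T := [set U | P (A `\` U)].
have FF : ProperFilter F.
  split; first by rewrite /F /= setD0.
  split.
  - by rewrite /F /= setDT.
  - by move=> B C FB FC; rewrite /F /= setDIr; exact: PU.
  - by move=> B C BC; apply: Psub; exact: setDS.
have FA : F A by rewrite /F /= setDv.
have [x [Ax clx]] := cA F FF FA.
have [U xU PUx] := Ploc x Ax.
have FU : F (~` U) by apply: Psub PUx => y [_ /contrapT].
by have [y []] := clx _ _ FU xU.
Qed.

Section clopen_algebra.
Context (T : ptopologicalType).

(** An alias whose measurable sets are the clopen sets. These form only an algebra, the domain from
    which the measure extension starts. *)
Definition clopen_algebra : Type := T.

HB.instance Definition _ := Pointed.on clopen_algebra.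

HB.instance Definition _ := @isAlgebraOfSets.Build default_measure_display
  clopen_algebra (@clopen T) (@clopen0 T) (@clopenU T) (fun A => @clopenC T A A).

End clopen_algebra.

Notation clopen_sigma T := (g_sigma_algebraType (@clopen T)).

Section cantor_clopen.

Lemma cantor_cylinder_clopen (x : cantor_space) (n : nat) :
  clopen [set y : cantor_space | forall i, (i < n)%N -> y i = x i].
Proof.
elim: n => [|n IH].
  rewrite (_ : [set _ | _] = setT); first exact: clopenT.
  by apply/seteqP; split.
rewrite (_ : [set _ | _] =
    [set y : cantor_space | forall i, (i < n)%N -> y i = x i] `&`
    (fun y : cantor_space => y n) @^-1` [set x n]).
  apply: clopenI => //; apply: preimage_clopen.
    by split; [exact: discrete_open|exact: discrete_closed].
  exact: (@proj_continuous nat (fun=> bool) n).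
apply/seteqP; split => y /= yx.
  by split; [move=> i /ltnW /yx|exact: yx].
by move=> i; rewrite ltnS leq_eqVlt => /predU1P[->|/yx.1]; [exact: yx.2|].
Qed.

(** The complement of [U] is compact and each of its points differs from [x] at some coordinate;
    compactness bounds that coordinate. *)
Lemma cantor_cylinder_nbhs (x : cantor_space) (U : set cantor_space) :
  open U -> U x ->
  exists n, [set y : cantor_space | forall i, (i < n)%N -> y i = x i] `<=` U.
Proof.
move=> oU Ux.
suff [n nP] : exists n, forall y, (~` U) y -> exists2 i, (i < n)%N & y i != x i.
  exists n => y /= yx; apply: contrapT => /nP[i /yx ->].
  by rewrite eqxx.
have cU : compact (~` U).
  apply: subclosed_compact cantor_space_compact _ => //.
  exact: open_closedC.
pose P (A : set cantor_space) := exists n, forall y, A y ->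
  exists2 i, (i < n)%N & y i != x i.
apply: (@compact_local_ind cantor_space _ P) => //.
- by exists 0%N.
- by move=> B C BC [n nP]; exists n => y /BC /nP.
- move=> B C [n nP] [m mP]; exists (maxn n m) => y [/nP|/mP][i im yi];
  by exists i => //; rewrite (leq_trans im)// ?leq_maxl ?leq_maxr.
- move=> y Uy.
  have [i yx] : exists i, y i != x i.
    apply: contrapT => /forallNP yx; apply: Uy.
    suff -> : y = x by [].
    apply: (@functional_extensionality_dep nat (fun=> bool) y x) => i.
    by apply/eqP/negPn/negP; exact: yx.
  exists ((fun y : cantor_space => y i) @^-1` [set y i]).
    apply: open_nbhs_nbhs; split => //; apply: open_comp; last exact: discrete_open.
    by move=> z _; exact: (@proj_continuous nat (fun=> bool) i).
  by exists i.+1 => z /= zy; exists i => //; rewrite zy.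
Qed.

(** There are countably many cylinders, coded as finite bit strings through [unpickle], and those
    inside [U] cover it. Hence open sets belong to the sigma-algebra generated by the clopen
    ones. *)
Lemma cantor_open_bigcup (U : set cantor_space) : open U ->
  exists D : nat -> set cantor_space, (forall n, clopen (D n)) /\ U = \bigcup_n D n.
Proof.
move=> oU.
pose cyl (s : seq bool) := [set y : cantor_space |
  forall i, (i < size s)%N -> y i = nth false s i].
have /choice[D DP] : forall n : nat, exists D : set cantor_space,
    [/\ clopen D, D `<=` U &
      forall s, unpickle n = Some s -> cyl s `<=` U -> cyl s `<=` D].
  move=> n; case sE : (unpickle n : option (seq bool)) => [s|]; last first.
    by exists set0; split => //; exact: clopen0.
  have [sU|nsU] := pselect (cyl s `<=` U); last first.
    by exists set0; split => // [|_ [<-] /nsU//]; exact: clopen0.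
  exists (cyl s); split => [|//|_ [<-] _ //].
  exact: (@cantor_cylinder_clopen (fun i => nth false s i)).
exists D; split; first by move=> n; case: (DP n).
apply/seteqP; split => [x Ux|x [n _]]; last by case: (DP n) => _ + _; exact.
have [n nU] := cantor_cylinder_nbhs oU Ux.
exists (pickle (mkseq x n)) => //; have [_ _] := DP (pickle (mkseq x n)).
apply; first by rewrite pickleK.
  apply: subset_trans nU => y /= yx i ilt.
  by rewrite yx ?size_mkseq// nth_mkseq.
by move=> i; rewrite size_mkseq => ilt; rewrite nth_mkseq.
Qed.

Lemma cantor_open_measurable (U : set cantor_space) :
  open U -> measurable (U : set (clopen_sigma cantor_space)).
Proof.
move=> /cantor_open_bigcup[D [cD ->]]; apply: bigcupT_measurable => n.
by apply: sub_gen_smallest; exact: cD.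
Qed.

End cantor_clopen.

Definition bfun (R : realType) (T : Type) (f : T -> R) : Prop :=
  exists M, forall x, `|f x| <= M.

Section bfun.
Context {R : realType} {T : Type}.
Implicit Types f g : T -> R.

Lemma bfun_cst (a : R) : bfun (fun _ : T => a).
Proof. by exists `|a|. Qed.

Lemma bfunD f g : bfun f -> bfun g -> bfun (f + g).
Proof.
move=> [M fM] [N gN]; exists (M + N) => x.
by rewrite (le_trans (ler_normD _ _))// lerD.
Qed.

Lemma bfunM f g : bfun f -> bfun g -> bfun (f * g).
Proof.
move=> [M fM] [N gN]; exists (M * N) => x.
by rewrite normrM ler_pM.
Qed.

Lemma bfunZ (a : R) f : bfun f -> bfun (a *: f).
Proof. by move=> bf; exact: (bfunM (bfun_cst a) bf). Qed.

Lemma bfun_indic (A : set T) : bfun (\1_A : T -> R).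
Proof. by exists 1 => x; rewrite indicE normr_nat; case: (x \in A). Qed.

Lemma bfun_continuous (U : topologicalType) (f : U -> R) :
  compact [set: U] -> continuous f -> bfun f.
Proof.
move=> cU cf.
have /compact_bounded[M [_ /(_ (M + 1))]] : compact (f @` setT).
  apply: continuous_compact => //.
  by apply: continuous_subspaceT => x; exact: cf.
rewrite ltrDl ltr01 => /(_ isT) fM; exists (M + 1) => x.
by apply: fM; exists x.
Qed.

End bfun.

Lemma open_preimage_measurable_fun d (T : measurableType d) (R : realType)
    (D : set T) (f : T -> R) :
  (forall U : set R, open U -> measurable (D `&` f @^-1` U)) ->
  measurable_fun D f.
Proof.
move=> mf; apply: (measurability _ (measurable_realfun.RGenOpens.measurableE R)).
by move=> _ [_ [a [b ->] <-]]; apply: mf; exact: interval_open.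
Qed.

(** * Positive functionals on bounded functions as measures *)

Section riesz_clopen.
Context {R : realType} {T : ptopologicalType}.
Hypothesis T_compact : compact [set: T].
Hypothesis T_clopen_basis : forall (x : T) (U : set T), nbhs x U ->
  exists2 D, clopen D /\ D x & D `<=` U.
Hypothesis T_open_measurable : forall U : set T, open U ->
  measurable (U : set (clopen_sigma T)).

Variable Lam : (T -> R) -> R.
Hypothesis LamD : forall f g, bfun f -> bfun g -> Lam (f + g) = Lam f + Lam g.
Hypothesis LamZ : forall a f, bfun f -> Lam (a *: f) = a * Lam f.
Hypothesis Lam_le : forall f a, bfun f -> (forall x, f x <= a) -> Lam f <= a.

Let Lam_ge f a : bfun f -> (forall x, a <= f x) -> a <= Lam f.
Proof.
move=> bf fa; have := @Lam_le ((-1) *: f) (- a).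
rewrite LamZ// mulN1r lerN2; apply; first exact: bfunZ.
by move=> x; rewrite -[_ x]/(-1 * f x) mulN1r lerN2.
Qed.

Let Lam_mono f g : bfun f -> bfun g -> (forall x, f x <= g x) -> Lam f <= Lam g.
Proof.
move=> bf bg fg; rewrite -subr_ge0 -mulN1r -LamZ// -LamD//; last exact: bfunZ.
apply: Lam_ge; first by apply: bfunD => //; exact: bfunZ.
by move=> x; rewrite -[_ x]/(g x + -1 * f x) mulN1r subr_ge0.
Qed.

Let lam (A : set T) : R := Lam \1_A.

Let lam0 : lam set0 = 0.
Proof.
apply/eqP; rewrite eq_le; apply/andP; split.
  by apply: Lam_le => [|x]; [exact: bfun_indic|rewrite indic0].
by apply: Lam_ge => [|x]; [exact: bfun_indic|rewrite indic0].
Qed.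

Let lam_ge0 A : 0 <= lam A.
Proof. by apply: Lam_ge => [|x]; [exact: bfun_indic|rewrite indicE]. Qed.

Let lamT : lam setT = 1.
Proof.
apply/eqP; rewrite eq_le; apply/andP; split.
  by apply: Lam_le => [|x]; [exact: bfun_indic|rewrite indicT].
by apply: Lam_ge => [|x]; [exact: bfun_indic|rewrite indicT].
Qed.

Let lamU A B : A `&` B = set0 -> lam (A `|` B) = lam A + lam B.
Proof.
move=> AB; rewrite /lam -LamD; [|exact: bfun_indic..].
congr Lam; apply/funext => x; rewrite -[RHS]/(\1_A x + \1_B x) !indicE in_setU.
have [xA|] := boolP (x \in A); have [xB|] := boolP (x \in B); rewrite ?addr0 ?add0r//=.
by have := in_setI x A B; rewrite AB in_set0 xA xB.
Qed.

Let content (A : set (clopen_algebra T)) : \bar R := (lam A)%:E.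

Let content0 : content set0 = 0%E.
Proof. by rewrite /content lam0. Qed.

Let content_ge0 A : (0 <= content A)%E.
Proof. by rewrite lee_fin lam_ge0. Qed.

(* A countable disjoint union of clopen sets that is clopen is compact, hence
   has only finitely many nonempty terms. *)
Let content_sigma_additive : semi_sigma_additive content.
Proof.
move=> F mF tF mUF.
have [N NP] : exists N, forall n, (N <= n)%N -> F n = set0.
  have [N NP] : exists N, \bigcup_n F n `<=` \bigcup_(n < N) F n.
    pose P (A : set T) := exists N, A `&` \bigcup_n F n `<=` \bigcup_(n < N) F n.
    suff [N] : P setT by rewrite setTI => ?; exists N.
    apply: (@compact_local_ind T _ P) => //.
    - by exists 0%N => x [].
    - by move=> B C BC [N NP]; exists N => x [/BC Cx Fx]; exact: NP.
    - move=> B C [N NP] [M MP]; exists (maxn N M) => x [[Bx|Cx] Fx].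
        have [n /= nN Fn] := NP _ (conj Bx Fx).
        by exists n => //=; rewrite leq_max nN.
      have [n /= nN Fn] := MP _ (conj Cx Fx).
      by exists n => //=; rewrite leq_max nN orbT.
    - move=> x _; have [[n _ Fn]|nF] := pselect ((\bigcup_n F n) x).
        exists (F n); last by exists n.+1 => y [Fy _]; exists n => /=.
        by apply: open_nbhs_nbhs; split => //; have [] := mF n.
      exists (~` \bigcup_n F n); last by exists 0%N => y [].
      by apply: open_nbhs_nbhs; split => //; apply: closed_openC; case: mUF.
  exists N => n Nn; apply/eqP/negP => /negP/set0P[x Fx].
  have [m /= mN Fm] := NP x (ex_intro2 _ _ n I Fx).
  have nm : n = m by apply: tF => //; exists x.
  by move: mN; rewrite -nm ltnNge Nn.
have sumE n : (\sum_(0 <= i < n) content (F i))%E = content (\big[setU/set0]_(i < n) F i).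
  rewrite big_mkord; elim: n => [|n IH]; first by rewrite !big_ord0 content0.
  rewrite !big_ord_recr/= IH /content lamU//.
  apply/seteqP; split => // x [].
  rewrite -bigcup_mkord => -[i /= + Fi] Fn.
  by have -> : i = n; [apply: tF => //; exists x|rewrite ltnn].
apply: cvg_near_cst; exists N => // n /= Nn; rewrite sumE; congr content.
apply/seteqP; split => x; rewrite -bigcup_mkord.
  by move=> [i _ Fi]; exists i.
move=> [i _ Fi]; exists i => //=; rewrite ltnNge; apply/negP => ni.
by move: Fi; rewrite NP// (leq_trans Nn).
Qed.

HB.instance Definition _ := isMeasure.Build default_measure_display
  (clopen_algebra T) R content content0 content_ge0 content_sigma_additive.

Let nu : set (clopen_sigma T) -> \bar R :=
  @measure_extension _ (clopen_algebra T) R content.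

Let nu0 : nu set0 = 0%E.
Proof.
exact: (@measure0 _ _ _ (@measure_extension _ (clopen_algebra T) R content)).
Qed.

Let nu_ge0 A : (0 <= nu A)%E.
Proof.
exact: (@measure_ge0 _ _ _ (@measure_extension _ (clopen_algebra T) R content)).
Qed.

Let nu_sigma_additive : semi_sigma_additive nu.
Proof.
exact: (@measure_semi_sigma_additive _ _ _
  (@measure_extension _ (clopen_algebra T) R content)).
Qed.

HB.instance Definition _ := isMeasure.Build _ (clopen_sigma T) R nu
  nu0 nu_ge0 nu_sigma_additive.

Let nu_clopen (A : set T) : clopen A -> nu A = (lam A)%:E.
Proof. by move=> cA; rewrite /nu /measure_extension measurable_mu_extE. Qed.

Let nuT : nu setT = 1%E.
Proof. by rewrite nu_clopen ?lamT//; exact: clopenT. Qed.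

HB.instance Definition _ := Measure_isProbability.Build _ (clopen_sigma T) R nu nuT.

(** On a clopen set where f stays within e / 2 of a constant, the functional and the integral lie
    within e times the mass of each other. Adding up such pieces gives one inequality up to e, and -
    f gives the other. *)
Lemma riesz_clopen : exists mu : probability (clopen_sigma T) R,
  forall f : T -> R, continuous f -> Lam f = \int[mu]_x f x.
Proof.
have [P lamE] : exists P : probability (clopen_sigma T) R,
    forall A, clopen A -> fine (P A) = lam A.
  by exists nu => A cA; rewrite /= nu_clopen.
have mclo A : clopen A -> measurable (A : set (clopen_sigma T)).
  by move=> cA; exact: sub_gen_smallest.
have intf f (A : set (clopen_sigma T)) : continuous f -> measurable A ->
    P.-integrable A (EFin \o f).
  move=> cf mA; have [M fM] := bfun_continuous T_compact cf.
  have mf : measurable_fun [set: clopen_sigma T] (f : clopen_sigma T -> R).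
    apply: open_preimage_measurable_fun => U oU; rewrite setTI.
    by apply: T_open_measurable; apply: open_comp => // x _; exact: cf.
  apply: (@integrableS _ _ _ P [set: clopen_sigma T]) => //.
  apply: measurable_bounded_integrable => //.
  - by rewrite (le_lt_trans (probability_le1 _ _)) ?ltry.
  - exists M; split; first exact: num_real.
    by move=> N MN x _ /=; rewrite (le_trans (fM x))// ltW.
have lamP (A : set T) f a : bfun f -> (forall x, A x -> f x <= a) ->
    Lam (f * \1_A) <= a * lam A.
  move=> bf fa; rewrite -LamZ; last exact: bfun_indic.
  apply: Lam_mono.
  - by apply: bfunM => //; exact: bfun_indic.
  - by apply: bfunZ; exact: bfun_indic.
  - move=> x; rewrite -[X in X <= _]/(f x * \1_A x) -[X in _ <= X]/(a * \1_A x) indicE.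
    by have [/set_mem/fa fxa|_] := boolP (x \in A); rewrite ?mulr1 ?mulr0.
have key e f : 0 < e -> continuous f -> Lam f <= \int[P]_x f x + e.
  move=> e0 cf; have bf := bfun_continuous T_compact cf.
  (* Asking the bound of every clopen part of [D] makes [Q] stable under unions: a clopen [B] inside
     the union of two such sets is cut along the first one. *)
  pose Q (A : set T) := exists D, [/\ clopen D, A `<=` D &
    forall B, clopen B -> B `<=` D ->
      Lam (f * \1_B) <= \int[P]_(x in B) f x + e * lam B].
  suff [D [_ DT QD]] : Q setT.
    have /(_ (subset_trans (@subsetT _ _) DT)) := QD _ clopenT.
    rewrite lamT mulr1 (_ : f * \1_setT = f); first exact.
    by apply/funext => x; rewrite -[LHS]/(f x * \1_setT x) indicT mulr1.
  have bf1 A : bfun (f * \1_A) by apply: bfunM => //; exact: bfun_indic.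
  apply: (@compact_local_ind T _ Q) => //.
  - exists set0; split => //; first exact: clopen0.
    move=> B _ B0; have -> : B = set0 by apply/seteqP; split.
    rewrite Rintegral_set0 lam0 mulr0 addr0.
    rewrite (_ : f * _ = 0 *: \1_set0); first by rewrite LamZ ?mul0r//; exact: bfun_indic.
    by apply/funext => x; rewrite -[LHS]/(f x * \1_set0 x) indic0 scale0r mulr0.
  - by move=> A B AB [D [cD BD QD]]; exists D; split => //; exact: subset_trans BD.
  - move=> A A' [D [cD AD QD]] [D' [cD' AD' QD']]; exists (D `|` D'); split.
    + exact: clopenU.
    + exact: setUSS.
    + move=> B cB BDD.
      have cBD : clopen (B `&` D) by exact: clopenI.
      have cBD' : clopen (B `&` ~` D) by apply: clopenI => //; exact: (clopenC D).
      have h1 := QD _ cBD (@subIsetr _ _ _).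
      have h2 : Lam (f * \1_(B `&` ~` D)) <=
          \int[P]_(x in B `&` ~` D) f x + e * lam (B `&` ~` D).
        by apply: QD' => // x [/BDD[]].
      have BE : B = (B `&` D) `|` (B `&` ~` D) by rewrite -setIUr setUv setIT.
      have B0 : (B `&` D) `&` (B `&` ~` D) = set0.
        by rewrite setIACA setICr setI0.
      rewrite [in X in _ <= X]BE lamU// Rintegral_setU//; first last.
      * by rewrite /disj_set B0 eqxx.
      * by apply: intf => //; rewrite -BE; exact: mclo.
      * exact: mclo.
      * exact: mclo.
      rewrite (_ : f * \1_B = f * \1_(B `&` D) + f * \1_(B `&` ~` D)).
        rewrite LamD//; lra.
      apply/funext => x.
      rewrite -[LHS]/(f x * \1_B x).
      rewrite -[RHS]/(f x * \1_(B `&` D) x + f x * \1_(B `&` ~` D) x).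
      rewrite !indicE !in_setI in_setC.
      by case: (x \in B); case: (x \in D); rewrite /= ?mulr0 ?addr0 ?add0r.
  - move=> x _.
    have /cf : nbhs (f x) (ball (f x) (e / 2)) by apply: nbhsx_ballx; lra.
    move=> /T_clopen_basis[D [cD Dx] Df]; exists D.
      by apply: open_nbhs_nbhs; split => //; case: cD.
    exists D; split => // B cB BD.
    have fle y : B y -> f y <= f x + e / 2.
      move=> /BD/Df; rewrite /ball/= ltr_distl => /andP[? ?]; lra.
    have fge y : B y -> f x - e / 2 <= f y.
      move=> /BD/Df; rewrite /ball/= ltr_distl => /andP[? ?]; lra.
    apply: (le_trans (lamP _ _ _ bf fle)).
    suff : (f x - e / 2) * lam B <= \int[P]_(x in B) f x by lra.
    have mB := mclo _ cB.
    rewrite -lamE// -Rintegral_cst//.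
    apply: le_Rintegral => //; last exact: intf.
    by apply: (intf (fun=> _)) => // y; exact: cvg_cst.
exists P => f cf; apply/eqP; rewrite eq_le; apply/andP; split.
  by apply/ler_addgt0Pr => e e0; exact: key.
have bf := bfun_continuous T_compact cf.
apply/ler_addgt0Pr => e e0.
have := @key e ((-1) *: f) e0.
rewrite LamZ// mulN1r (_ : \int[P]_x _ = - \int[P]_x f x); last first.
  by rewrite -[RHS]mulN1r -(RintegralZl _ _ (intf _ _ cf measurableT)).
suff cNf : continuous (-1 *: f) by move=> /(_ cNf); lra.
move=> x; rewrite -[_ *: f]/(fun y => -1 * f y).
by apply: cvgM; [exact: cvg_cst|exact: cf].
Qed.

End riesz_clopen.

(** The inequalities [f <= a] contained in [E] make the functional positive and of mass 1, and make
    every bounded function two-sided. *)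
Lemma cone_measure (R : realType) (E : set (R * (cantor_space -> R)))
    (f0 : cantor_space -> R) (v : R) :
  proper_cone E -> (forall f a, (forall x, f x <= a) -> E (a, f)) ->
  continuous f0 -> infimums [set a | E (a, f0)] v ->
  exists mu : probability (clopen_sigma cantor_space) R,
    \int[mu]_x f0 x = v /\
    forall f a, continuous f -> E (a, f) -> \int[mu]_x f x <= a.
Proof.
move=> coneE Ele cf0 infv.
have two f : bfun f -> two_sided E f.
  move=> [M fM]; split; exists M; apply: Ele => x.
    exact: le_trans (ler_norm _) (fM x).
  by rewrite -[(- f) x]/(- f x) (le_trans (ler_norm _))// normrN.
have bcont := bfun_continuous cantor_space_compact.
have [Lam [Lam0 LamD LamZ Lamle]] := cone_functional coneE (two _ (bcont _ _ cf0)) infv.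
have [|||||mu muP] := @riesz_clopen R cantor_space cantor_space_compact _ _ Lam.
- move=> x U xU; have := @zero_dimensional_cvg cantor_space x.
  move=> /(_ cantor_space_hausdorff cantor_zero_dimensional cantor_space_compact).
  by move=> /(_ _ xU)[D [Dx cD] DU]; exists D.
- exact: cantor_open_measurable.
- by move=> f g bf bg; apply: LamD; exact: two.
- by move=> a f bf; apply: LamZ; exact: two.
- by move=> f a bf fa; apply: Lamle; [exact: two|exact: Ele].
exists mu; split; first by rewrite -muP.
by move=> f a cf Ef; rewrite -muP//; apply: Lamle => //; exact/two/bcont.
Qed.

(** * Compact metrizable sets as continuous images of the Cantor space *)

Section cantor_metrizable.
Context {R : realType} {X : topologicalType} (K L : set X).
Hypotheses (LK : L `<=` K) (L_compact : compact L).
Variables (d : set_type K -> set_type K -> R) (p : set_type L).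
Hypotheses (d0 : forall x y, d x y = 0 <-> x = y)
  (d_sym : forall x y, d x y = d y x)
  (d_triangle : forall x y z, d x z <= d x y + d y z)
  (d_open : forall U : set (set_type K), open U <->
     forall x, U x -> exists2 e : R, 0 < e & [set y | d x y < e] `<=` U).

Let inc (x : set_type L) : set_type K :=
  exist _ (val x) (mem_set (LK (set_mem (valP x)))).

(** A separate type for the points of [L], topologized by the metric; [ball_open] and
    [val_continuous] compare this topology with that of [X]. *)
Definition metric_copy : Type := set_type L.

HB.instance Definition _ := Choice.on metric_copy.
HB.instance Definition _ := isPointed.Build metric_copy p.

Let val_in (x : metric_copy) : L (val x).
Proof. by apply: set_mem; exact: (valP (x : set_type L)). Qed.

Let dist (x y : metric_copy) : R := d (inc x) (inc y).

Let distxx x : dist x x = 0. Proof. exact/d0. Qed.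

Let dist_eq0 x y : dist x y = 0 -> x = y.
Proof. by move=> /d0 /(congr1 val) xy; exact: val_inj. Qed.

Let dist_sym x y : dist x y = dist y x. Proof. exact: d_sym. Qed.

Let dist_triangle y x z : dist x z <= dist x y + dist y z.
Proof. exact: d_triangle. Qed.

HB.instance Definition _ :=
  isMetric.Build R metric_copy distxx dist_eq0 dist_sym dist_triangle.

Let ball_open (x : metric_copy) (e : R) : 0 < e ->
  exists V : set X, [/\ open V, V (val x) &
    forall y : metric_copy, V (val y) -> ball x e y].
Proof.
move=> e0.
have : open [set y | d (inc x) y < e].
  apply/d_open => y /= xy; exists (e - d (inc x) y); first by rewrite subr_gt0.
  by move=> z /=; rewrite ltrBrDl; exact: le_lt_trans (d_triangle _ _ _).
move=> [V oV VE]; exists V; split => //.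
  have : (set_val @^-1` V) (inc x) by rewrite VE/= (iffRL (d0 _ _)).
  by [].
move=> y Vy; have : (set_val @^-1` V) (inc y) by [].
by rewrite VE.
Qed.

Let metric_copy_compact : compact [set: metric_copy].
Proof.
move=> F FF _.
pose G : set_system X := (fun x : metric_copy => val x) @ F.
have FG : ProperFilter G by exact: fmap_proper_filter.
have GL : G L.
  by apply: (@filterS _ F _ setT) => [x _|]; [exact: (val_in x)|exact: filterT].
have [x [Lx clx]] := L_compact FG GL.
exists (exist _ x (mem_set Lx) : metric_copy); split => // A U FA.
move=> /nbhs_ballP[e /= e0 eU].
have [V [oV Vx VP]] := ball_open (exist _ x (mem_set Lx)) e0.
have GA : G [set y | exists2 a : metric_copy, A a & val a = y].
  by apply: (@filterS _ F _ A) => // a Aa; exists a.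
have [_ [[a Aa <-] Va]] := clx _ _ GA (open_nbhs_nbhs (conj oV Vx)).
by exists a; split => //; apply/eU/VP.
Qed.

Let val_continuous : continuous (fun x : metric_copy => val x : X).
Proof.
move=> x U; rewrite nbhsE => -[V [oV Vx] VU].
have : open ((set_val : set_type K -> X) @^-1` V) by exists V.
move=> /d_open/(_ (inc x) Vx)[e e0 eV].
apply/nbhs_ballP; exists e => //= y xy; apply: VU.
exact: (eV (inc y)).
Qed.

(** The Alexandroff-Hausdorff theorem, applied to the metric copy of [L]. *)
Lemma metrizable_cantor_image :
  exists pi : cantor_space -> X, continuous pi /\ range pi = L.
Proof.
have [|f cf] := @cantor_surj R metric_copy metric_copy_compact.
  exact: metric_hausdorff.
exists (fun c => val (f c)); split.
  by move=> c; apply: continuous_comp; [exact: cf|exact: val_continuous].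
apply/seteqP; split => [_ [c _ <-]|x Lx]; first exact: val_in.
have [c _ cx] := @surj _ _ _ _ f (exist _ x (mem_set Lx) : metric_copy) I.
by exists c => //; rewrite cx.
Qed.

End cantor_metrizable.

Lemma compact_metrizable_cantor_image (R : realType) (X : topologicalType)
    (K L : set X) :
  metrizable R (set_type K) -> L `<=` K -> compact L -> L !=set0 ->
  exists pi : cantor_space -> X, continuous pi /\ range pi = L.
Proof.
move=> [d [_ d0 ds dt dO]] LK cL [x Lx].
exact: (metrizable_cantor_image LK cL (exist _ x (mem_set Lx)) d0 ds dt dO).
Qed.

(** * Cylindrical functionals *)

Section continuous_real.
Context {R : realType} {T : topologicalType}.
Implicit Types f g : T -> R.

Lemma continuous_addr f g :
  continuous f -> continuous g -> continuous (fun x => f x + g x).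
Proof. by move=> cf cg x; apply: cvgD; [exact: cf|exact: cg]. Qed.

Lemma continuous_mulr f g :
  continuous f -> continuous g -> continuous (fun x => f x * g x).
Proof. by move=> cf cg x; apply: cvgM; [exact: cf|exact: cg]. Qed.

Lemma continuous_sumr (I : Type) (s : seq I) (F : I -> T -> R) :
  (forall i, continuous (F i)) -> continuous (fun x => \sum_(i <- s) F i x).
Proof.
by move=> cF; apply: (continuous_big add_continuous) => i _; exact: cF.
Qed.

End continuous_real.

Section C1_functions.
Context {R : realType} {m : nat}.
Implicit Types (psi f g : 'rV[R]_m -> R).

(** Profiles without compact support, for intermediate constructions; [cyl_realize] turns them into
    genuine test functionals. *)
Definition C1 psi : Prop :=
  (forall x, differentiable psi x) /\ forall v, continuous (fun x => 'D_v psi x).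

Lemma C1_continuous psi : C1 psi -> continuous psi.
Proof. by move=> [dpsi _] x; exact: differentiable_continuous. Qed.

Lemma derive_row_sum psi x v : differentiable psi x ->
  'D_v psi x = \sum_j v 0 j * 'D_(delta_mx 0 j) psi x.
Proof.
move=> dpsi; rewrite deriveE// [X in 'd _ _ X]row_sum_delta linear_sum/=.
by apply: eq_bigr => j _; rewrite linearZ/= deriveE.
Qed.

Lemma C1c_C1 psi : C1c psi -> C1 psi.
Proof.
move=> [dpsi cpsi _]; split => // v.
rewrite (_ : 'D_v _ = fun x => \sum_j v 0 j * 'D_(delta_mx 0 j) psi x); last first.
  by apply/funext => x; exact: derive_row_sum.
apply: continuous_sumr => j.
by apply: continuous_mulr; [exact: cst_continuous|exact: cpsi].
Qed.

Lemma C1_cst (a : R) : C1 (fun _ => a).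
Proof.
split=> [x|v]; first exact: differentiable_cst.
rewrite (_ : 'D_v _ = fun=> 0); first exact: cst_continuous.
by apply/funext => x; exact: derive_cst.
Qed.

Lemma C1D f g : C1 f -> C1 g -> C1 (f + g).
Proof.
move=> [df cf] [dg cg]; split=> [x|v].
  exact: differentiableD.
rewrite (_ : 'D_v _ = fun x => 'D_v f x + 'D_v g x); last first.
  by apply/funext => x; rewrite deriveD//; exact: diff_derivable.
by apply: continuous_addr; [exact: cf|exact: cg].
Qed.

Lemma C1M f g : C1 f -> C1 g -> C1 (f * g).
Proof.
move=> C1f C1g; have [df cf] := C1f; have [dg cg] := C1g; split=> [x|v].
  exact: differentiableM.
rewrite (_ : 'D_v _ = fun x => f x * 'D_v g x + g x * 'D_v f x); last first.
  by apply/funext => x; rewrite deriveM//; exact: diff_derivable.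
apply: continuous_addr; apply: continuous_mulr.
- exact: C1_continuous.
- exact: cg.
- exact: C1_continuous.
- exact: cf.
Qed.

Lemma C1_coord (j : 'I_m) : C1 (fun x => x 0 j).
Proof.
have E v x : 'D_v (fun y : 'rV[R]_m => y 0 j) x = v 0 j.
  have := derive_mx (@derivable_id _ _ x v).
  by rewrite derive_id => /matrixP/(_ 0 j) ->; rewrite mxE.
split=> [x|v]; first exact: differentiable_coord.
rewrite (_ : 'D_v _ = fun=> v 0 j); first exact: cst_continuous.
exact/funext.
Qed.

Lemma C1_sum (I : Type) (s : seq I) (F : I -> 'rV[R]_m -> R) :
  (forall i, C1 (F i)) -> C1 (\sum_(i <- s) F i).
Proof. by move=> C1F; elim/big_ind: _ => //; [exact: C1_cst|exact: C1D]. Qed.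

End C1_functions.

(** * Cutoff functions of class C1 *)

Section pos_sqr.
Context {R : realType}.

Definition pos_sqr (s : R) : R := Num.max 0 s ^+ 2.

(** A second-order remainder bound, uniform in [x]: it yields the derivative at every point, 0
    included. *)
Lemma pos_sqr_ineq (x h : R) :
  `|pos_sqr (x + h) - pos_sqr x - 2 * Num.max 0 x * h| <= h ^+ 2.
Proof.
rewrite /pos_sqr ler_norml !expr2.
by case: (leP 0 x) => ?; case: (leP 0 (x + h)) => ?; apply/andP; split; nra.
Qed.

Lemma is_derive_pos_sqr (x : R) : is_derive x 1 pos_sqr (2 * Num.max 0 x).
Proof.
have E : h^-1 *: (pos_sqr (h *: 1 + x) - pos_sqr x) @[h --> 0^'] -->
    2 * Num.max 0 x.
  apply/cvgrPdist_le => e e0; near=> h.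
  have h0 : h != 0 by near: h; exact: nbhs_dnbhs_neq.
  have he : `|h| <= e.
    near: h; apply: nbhs_dnbhs.
    by have := @cvg_id _ (nbhs (0 : R)) => /cvgrPdist_le/(_ _ e0);
      apply: filterS => y; rewrite sub0r normrN.
  rewrite distrC -[_ *: _]/(h^-1 * _) -[h *: 1]/(h * 1) mulr1 (addrC h).
  rewrite -(ler_pM2l (x := `|h|)) ?normr_gt0// -normrM mulrBr mulVKf//.
  rewrite (mulrC h (2 * _)) (le_trans (pos_sqr_ineq _ _))//.
  by rewrite -real_normK ?num_real// expr2 ler_wpM2l.
by apply: DeriveDef; [apply/cvg_ex; eexists; exact: E|exact: cvg_lim E].
Unshelve. all: by end_near. Qed.

Lemma derive_pos_sqr_comp m (f : 'rV[R]_m -> R) x v : differentiable f x ->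
  differentiable (pos_sqr \o f) x /\
  'D_v (pos_sqr \o f) x = 2 * Num.max 0 (f x) * 'D_v f x.
Proof.
move=> df; have [dq Dq] := is_derive_pos_sqr (f x).
have dqf : differentiable (pos_sqr \o f) x.
  by apply: differentiable_comp => //; exact/derivable1_diffP.
split => //; rewrite deriveE// diff_comp//=; last exact/derivable1_diffP.
by rewrite -(deriveE v df) deriv1E// derive1E Dq -[_ *: _]/(_ * _) mulrC.
Qed.

Lemma C1_pos_sqr_comp m (f : 'rV[R]_m -> R) : C1 f -> C1 (pos_sqr \o f).
Proof.
move=> C1f; have [df cf] := C1f; split=> [x|v].
  by have [] := derive_pos_sqr_comp 0 (df x).
rewrite (_ : 'D_v _ = fun x => 2 * Num.max 0 (f x) * 'D_v f x); last first.
  by apply/funext => x; rewrite (derive_pos_sqr_comp v (df _)).2.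
apply: continuous_mulr; last exact: cf.
apply: continuous_mulr; first exact: cst_continuous.
move=> x; apply: (@continuous_max _ _ (fun=> 0) f); first exact: cst_continuous.
exact: C1_continuous.
Qed.

End pos_sqr.

Section cutoff.
Context {R : realType} (m : nat) (r : R).

Definition sumsq (x : 'rV[R]_m) : R := \sum_j x 0 j ^+ 2.

(** The inner [pos_sqr] vanishes while [sumsq x <= r] and is at least 1 once [sumsq x >= r + 1]. *)
Definition cutoff : 'rV[R]_m -> R :=
  pos_sqr \o (fun x => 1 - pos_sqr (sumsq x - r)).

Lemma C1_sumsq : C1 sumsq.
Proof.
rewrite (_ : sumsq = \sum_j ((fun x : 'rV_m => x 0 j) * (fun x => x 0 j))).
  by apply: C1_sum => j; apply: C1M; exact: C1_coord.
apply/funext => x; rewrite fct_sumE; apply: eq_bigr => j _; exact: expr2.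
Qed.

Let C1_inner : C1 (fun x => 1 - pos_sqr (sumsq x - r)).
Proof.
apply: (@C1D _ _ (fun=> 1) (fun x => - pos_sqr (sumsq x - r))).
  exact: C1_cst.
rewrite (_ : (fun _ => _) = (fun=> -1) * (pos_sqr \o (sumsq + (fun=> - r)))).
  apply: C1M; first exact: C1_cst.
  by apply: C1_pos_sqr_comp; apply: C1D; [exact: C1_sumsq|exact: C1_cst].
by apply/funext => x; rewrite -[RHS]/(-1 * pos_sqr (sumsq x - r)) mulN1r.
Qed.

Lemma C1_cutoff : C1 cutoff.
Proof. exact: C1_pos_sqr_comp. Qed.

Lemma cutoff1 x : sumsq x <= r -> cutoff x = 1.
Proof.
move=> xr; rewrite /cutoff/= /pos_sqr (_ : Num.max 0 (_ - r) = 0).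
  by rewrite expr0n subr0 max_r// expr1n.
by apply/max_idPl; rewrite subr_le0.
Qed.

Lemma derive_cutoff x v : sumsq x <= r -> 'D_v cutoff x = 0.
Proof.
move=> xr; have [di _] := C1_inner.
rewrite (derive_pos_sqr_comp v (di x)).2.
rewrite (_ : (fun x => 1 - _) = (fun=> 1) - (pos_sqr \o (fun x => sumsq x - r)))//.
have ds : differentiable (fun x => sumsq x - r) x.
  by apply: differentiableB => //; have [] := C1_sumsq.
have [dq Dq] := derive_pos_sqr_comp v ds.
rewrite deriveB//; last exact: diff_derivable.
rewrite derive_cst Dq (_ : Num.max 0 (_ - r) = 0); last first.
  by apply/max_idPl; rewrite subr_le0.
by rewrite mulr0 mul0r subr0 mulr0.
Qed.

Lemma cutoff0 x : r + 1 <= sumsq x -> cutoff x = 0.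
Proof.
move=> xr; rewrite /cutoff/= {1}/pos_sqr (_ : Num.max 0 _ = 0) ?expr0n//.
apply/max_idPl; rewrite subr_le0 /pos_sqr max_r; last by lra.
by rewrite exprn_ege1//; lra.
Qed.

Lemma sumsq_le_compact a : compact [set x | sumsq x <= a].
Proof.
apply: bounded_closed_compact; last first.
  rewrite (_ : [set _ | _] = sumsq @^-1` [set y | y <= a])//.
  apply: closed_comp; last exact: closed_le.
  by move=> x _; apply: C1_continuous; exact: C1_sumsq.
(* The bound [1 + a] avoids a square root: each squared coordinate is at most a <= (1 + a)^2. *)
exists (1 + a); split => [|b ab x /= xa]; first exact: num_real.
have sum0 : 0 <= sumsq x by apply: sumr_ge0 => j _; exact: sqr_ge0.
rewrite [leLHS]/Num.Def.normr /= mx_normrE; apply/bigmax_leP; split; first by lra.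
move=> [i j] _ /=; rewrite (ord1 i).
have : x 0 j ^+ 2 <= sumsq x.
  by rewrite /sumsq (bigD1 j)//= lerDl; apply: sumr_ge0 => k _; exact: sqr_ge0.
rewrite -real_normK ?num_real// => xj.
rewrite -(@ler_pXn2r _ 2)// ?nnegrE//; last by lra.
by rewrite (le_trans xj)//; nra.
Qed.

End cutoff.

Lemma C1_comp_linear (R : realType) (m n : nat) (psi : 'rV[R]_m -> R)
    (p : {linear 'rV[R]_n -> 'rV[R]_m}) :
  C1 psi -> (forall x, differentiable p x) ->
  C1 (psi \o p) /\ forall v x, 'D_v (psi \o p) x = 'D_(p v) psi (p x).
Proof.
move=> [dpsi cpsi] dp.
have D v x : 'D_v (psi \o p) x = 'D_(p v) psi (p x).
  rewrite /derive /shift/=.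
  by under eq_fun do rewrite linearP.
split => //; split=> [x|v]; first exact: differentiable_comp.
rewrite (_ : 'D_v _ = 'D_(p v) psi \o p); last by apply/funext => x; exact: D.
move=> x; apply: continuous_comp; last exact: cpsi.
exact: differentiable_continuous.
Qed.

Section cyl_realize.
Context {R : realType} {W : normedModType R}.

Definition pairing_row m (w : 'I_m -> W) (f : dual W) : 'rV[R]_m :=
  \row_j f (w j).

Lemma cyl_deriv_row (Psi : cyl W) (u f : dual W) :
  f (cyl_deriv Psi u) = 'D_(pairing_row (@cyl_dir _ _ Psi) f)
    (@cyl_prof _ _ Psi) (cyl_coord Psi u).
Proof.
have [dpsi _ _] := cyl_profP Psi.
rewrite derive_row_sum// /cyl_deriv (linear_sum (f : {linear W -> R^o}))/=.
apply: eq_bigr => j _; rewrite (linearZ_LR (f : {linear W -> R^o}))/= mxE.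
by rewrite [LHS]mulrC.
Qed.

(* Compact support of the profile costs nothing on a set with bounded
   coordinates: multiply by a cutoff equal to 1 there. *)
Lemma cyl_realize (L : set (dual W)) m (w : 'I_m -> W) (psi : 'rV[R]_m -> R) :
  C1 psi -> (forall j, exists M, forall u, L u -> `|u (w j)| <= M) ->
  exists Psi : cyl W, forall u f : dual W, L u ->
    f (cyl_deriv Psi u) = 'D_(pairing_row w f) psi (pairing_row w u).
Proof.
move=> C1psi /choice[M LM].
pose r := \sum_j M j ^+ 2.
have Lr u : L u -> sumsq (pairing_row w u) <= r.
  move=> Lu; apply: ler_sum => j _; rewrite mxE.
  rewrite -real_normK ?num_real// lerXn2r ?nnegrE//; last exact: LM.
  exact: le_trans (LM j _ Lu).
have C1p : C1 (psi * cutoff r) by apply: C1M => //; exact: C1_cutoff.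
have cp : C1c (psi * cutoff r).
  split; [exact: C1p.1|by move=> j; exact: C1p.2|].
  apply: subclosed_compact (@sumsq_le_compact _ m (r + 1)) _; first exact: closed_closure.
  rewrite [X in _ `<=` X](closure_id _).1; last first.
    exact: compact_closed (@sumsq_le_compact _ m (r + 1)).
  apply: closure_subset => x /=; apply: contraNP => /negP; rewrite -ltNge => xr.
  by rewrite -[(psi * _) x]/(psi x * cutoff r x) cutoff0 ?mulr0// ltW.
exists (@Cyl _ _ m w _ cp) => u f /Lr ur.
rewrite cyl_deriv_row/= -/(pairing_row w f).
rewrite -[cyl_coord _ u]/(pairing_row w u).
rewrite deriveM; [|apply: diff_derivable; exact: C1psi.1|
  apply: diff_derivable; exact: (C1_cutoff _ _).1].
by rewrite derive_cutoff// cutoff1// scaler0 add0r scale1r.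
Qed.

(** A sum of profiles in separate variables is not compactly supported in general, so the
    derivatives are added only on a set with bounded coordinates, through [cyl_realize]. *)
Lemma cyl_add (L : set (dual W)) (Psi1 Psi2 : cyl W) :
  (forall w, exists M, forall u, L u -> `|u w| <= M) ->
  exists Psi : cyl W, forall u f : dual W, L u ->
    f (cyl_deriv Psi u) = f (cyl_deriv Psi1 u) + f (cyl_deriv Psi2 u).
Proof.
move=> bL; set m1 := cyl_dim Psi1; set m2 := cyl_dim Psi2.
pose w (j : 'I_(m1 + m2)) : W :=
  match fintype.split j with
  | inl i => @cyl_dir _ _ Psi1 i | inr i => @cyl_dir _ _ Psi2 i end.
pose psi1 : 'rV[R]_m1 -> R := @cyl_prof _ _ Psi1.
pose psi2 : 'rV[R]_m2 -> R := @cyl_prof _ _ Psi2.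
have C1psi1 : C1 psi1 by apply: C1c_C1; exact: cyl_profP.
have C1psi2 : C1 psi2 by apply: C1c_C1; exact: cyl_profP.
pose p1 : 'rV[R]_(m1 + m2) -> R := psi1 \o lsubmx.
pose p2 : 'rV[R]_(m1 + m2) -> R := psi2 \o rsubmx.
have [C1p1 Dp1] : C1 p1 /\ forall v x, 'D_v p1 x = 'D_(lsubmx v) psi1 (lsubmx x).
  by apply: C1_comp_linear => // x; exact: differentiable_lsubmx.
have [C1p2 Dp2] : C1 p2 /\ forall v x, 'D_v p2 x = 'D_(rsubmx v) psi2 (rsubmx x).
  by apply: C1_comp_linear => // x; exact: differentiable_rsubmx.
have [Psi PsiP] := @cyl_realize L _ w (p1 + p2) (C1D C1p1 C1p2) (fun j => bL (w j)).
exists Psi => u f Lu; rewrite PsiP// deriveD; [|apply: diff_derivable..]; first last.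
- exact: C1p2.1.
- exact: C1p1.1.
have lsubE g : lsubmx (pairing_row w g) = pairing_row (@cyl_dir _ _ Psi1) g.
  apply/rowP => j; rewrite !mxE /w.
  by rewrite -[lshift m2 j]/(unsplit (inl j)) unsplitK.
have rsubE g : rsubmx (pairing_row w g) = pairing_row (@cyl_dir _ _ Psi2) g.
  apply/rowP => j; rewrite !mxE /w.
  by rewrite -[rshift m1 j]/(unsplit (inr j)) unsplitK.
by rewrite Dp1 Dp2 !lsubE !rsubE !cyl_deriv_row.
Qed.

Lemma cyl_scale (L : set (dual W)) (t : R) (Psi1 : cyl W) :
  (forall w, exists M, forall u, L u -> `|u w| <= M) ->
  exists Psi : cyl W, forall u f : dual W, L u ->
    f (cyl_deriv Psi u) = t * f (cyl_deriv Psi1 u).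
Proof.
move=> bL; have C1psi : C1 (@cyl_prof _ _ Psi1) by apply: C1c_C1; exact: cyl_profP.
have [Psi PsiP] := @cyl_realize L _ (@cyl_dir _ _ Psi1) _
  (C1M (C1_cst t) C1psi) (fun j => bL _).
exists Psi => u f Lu; rewrite PsiP// deriveM; [|apply: diff_derivable..]; first last.
- exact: C1psi.1.
- exact: (C1_cst t).1.
by rewrite derive_cst scaler0 addr0 cyl_deriv_row.
Qed.

End cyl_realize.

(** * Dynamics *)

Section semigroup_dynamics.
Context {R : realType} {X : topologicalType}.
Variables (S : R -> X -> X) (B K : set X).
Hypotheses (X_hausdorff : hausdorff_space X)
  (S_semigroup : continuous_semigroup S)
  (B_neq0 : B !=set0) (B_invariant : positively_invariant S B)
  (B_closed : closed B) (K_compact : compact K)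
  (K_attracts : attracts_points S K B).

Let L := B `&` K.

Lemma semigroup_joint_cvg (t : R) (u : X) : 0 <= t ->
  (fun z : R * X => S z.1 z.2) @
    within (`[0, +oo[ `*` [set: X]) (nbhs (t, u)) --> S t u.
Proof.
move=> t0; have [/subspace_continuousP cS _ _] := S_semigroup.
by apply: (cS (t, u)); split => //=; rewrite in_itv/= t0.
Qed.

Lemma semigroup_continuous t : 0 <= t -> continuous (S t).
Proof.
move=> t0 u V /(semigroup_joint_cvg t0)[[P Q] /= [Pt Qu] PQ].
apply: filterS Qu => y Qy; apply: (PQ (t, y)); split => //=.
  exact: nbhs_singleton.
by rewrite in_itv/= t0.
Qed.

Lemma comp_semigroup_within_continuous (g : X -> R) (t : R) : 0 <= t ->
  {within B, continuous g} -> {within B, continuous (fun u => g (S t u))}.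
Proof.
move=> t0 cg; apply/subspace_continuousP => u Bu U gU.
have /(semigroup_continuous t0) :
    nbhs (S t u) [set y | B y -> U (g y)].
  by have /subspace_continuousP cg' := cg; exact: (cg' _ (B_invariant t0 Bu)).
apply: (@filterS _ (nbhs u)) => y Uy By; apply: Uy; exact: B_invariant.
Qed.

Lemma trajectory_continuous u :
  {within `[0, +oo[, continuous (fun t => S t u)}.
Proof.
apply/subspace_continuousP => t; rewrite /= in_itv/= andbT => t0 V.
move=> /(semigroup_joint_cvg t0)[[P Q] /= [Pt Qu] PQ].
apply: filterS Pt => y Py y0; apply: (PQ (y, u)); split => //=.
exact: nbhs_singleton.
Qed.

Lemma hausdorff_compact_separate y (A : set X) : compact A -> ~ A y ->
  exists U V, [/\ open U, nbhs y V, A `<=` U & U `&` V = set0].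
Proof.
move=> cA nAy.
pose P (C : set X) := exists U V, [/\ open U, nbhs y V, C `<=` U & U `&` V = set0].
apply: (@compact_local_ind X A P) => //.
- exists set0, setT; split => //; [exact: open0|exact: filterT|by rewrite set0I].
- by move=> C D CD [U [V [? ? DU ?]]]; exists U, V; split => //; exact: subset_trans DU.
- move=> C D [U [V [oU yV CU UV]]] [U' [V' [oU' yV' DU' UV']]].
  exists (U `|` U'), (V `&` V'); split.
  + exact: openU.
  + exact: filterI.
  + exact: setUSS.
  + by apply/seteqP; split => // z [[Uz|Uz] [Vz Vz']]; [rewrite -UV|rewrite -UV'].
- move=> x Ax; have xy : x != y by apply/eqP => xy; apply: nAy; rewrite -xy.
  have := X_hausdorff; rewrite open_hausdorff => /(_ x y xy).
  move=> [[U V] /= [Ux Vy] [oU oV UV]].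
  exists U; first by apply: open_nbhs_nbhs; split => //; exact: set_mem.
  exists U, V; split => //; last exact/eqP.
  by apply: open_nbhs_nbhs; split => //; exact: set_mem.
Qed.

Lemma BK_compact : compact L.
Proof. by rewrite /L setIC; exact: compact_closedI. Qed.

(** The trajectory stays in [B], so [V] may be enlarged by the open complement of [B]; the result is
    a neighbourhood of [K]. *)
Lemma attracted u0 V : B u0 -> open V -> L `<=` V -> \forall t \near +oo, V (S t u0).
Proof.
move=> Bu0 oV LV.
have [||T T0 TP] := K_attracts Bu0 (O := V `|` ~` B).
- by apply: openU => //; exact: closed_openC.
- by move=> x Kx; have [Bx|] := pselect (B x); [left; apply: LV|right].
near=> t.
have t0 : 0 <= t by near: t; exact: nbhs_pinfty_ge.
by have [//|] : (V `|` ~` B) (S t u0);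
  [apply: TP; near: t; apply: nbhs_pinfty_ge; exact: num_real|
   move=> /(_ (B_invariant t0 Bu0))].
Unshelve. all: by end_near. Qed.

Let orbit_filter u0 : set_system X := (fun t => S t u0) @ +oo.

Let omega_sub u0 y : B u0 -> cluster (orbit_filter u0) y -> L y.
Proof.
move=> Bu0 cly; apply: contrapT => nLy.
have [U [V [oU yV LU UV]]] := hausdorff_compact_separate BK_compact nLy.
have [z [Uz Vz]] := cly _ _ (attracted Bu0 oU LU) yV.
by have : (U `&` V) z by []; rewrite UV.
Qed.

(** Otherwise each point of [L] has an open neighbourhood that the trajectory eventually avoids; by
    compactness so does [L], against [attracted]. *)
Let omega_neq0 u0 : B u0 -> cluster (orbit_filter u0) !=set0.
Proof.
move=> Bu0; apply: contrapT => /forallNP ncl.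
pose P (A : set X) := exists2 V, open V /\ A `<=` V & \forall t \near +oo, ~ V (S t u0).
suff [V [oV LV] nV] : P L.
  near (@pinfty_nbhs R) => t.
  have : V (S t u0) by near: t; exact: attracted.
  by near: t.
apply: (@compact_local_ind X L P) => //.
- exact: BK_compact.
- by exists set0; [split => //; exact: open0|near=> t].
- by move=> C D CD [V [oV DV] nV]; exists V => //; split => //; exact: subset_trans DV.
- move=> C D [V [oV CV] nV] [V' [oV' DV'] nV']; exists (V `|` V').
    by split; [exact: openU|exact: setUSS].
  by near=> t; move=> [|]; near: t.
- move=> x _; have := ncl x; rewrite /cluster /= /meets.
  move=> /existsNP[A] /existsNP[V] /not_implyP[FA] /not_implyP[xV].
  move=> /set0P/negP/negPn/eqP AV.
  move: xV; rewrite nbhsE => -[V' [oV' V'x] V'V].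
  exists V'; first by exists V'.
  exists V'; first by split.
  have FA' : \forall t \near +oo, A (S t u0) by exact: FA.
  apply: filterS FA' => t At /V'V Vt.
  by have : (A `&` V) (S t u0) by []; rewrite AV.
Unshelve. all: by end_near. Qed.

(** [S t] maps cluster points of an orbit to cluster points of it, because applying [S t] along the
    orbit only shifts time. *)
Lemma omega_trajectory : exists u, forall t, 0 <= t -> L (S t u).
Proof.
have [u0 Bu0] := B_neq0; have [u clu] := omega_neq0 Bu0.
have [_ _ SD] := S_semigroup.
exists u => t t0; apply: (omega_sub Bu0) => A V FA.
move=> /(semigroup_continuous t0) tV.
have FA' : orbit_filter u0 (S t @^-1` A).
  (* The maximum with 0 keeps [s] nonnegative, as the semigroup law requires. *)
  move: FA => [M [Mr MA]]; exists (Num.max 0 M); split; first exact: num_real.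
  move=> s; rewrite gt_max => /andP[s0 Ms].
  rewrite /= -SD//; last exact: ltW.
  by apply: MA; rewrite (lt_le_trans Ms)// lerDr.
have [z [Az Vz]] := clu _ _ FA' tV.
by exists (S t z).
Qed.

Lemma BK_neq0 : L !=set0.
Proof.
have [u uL] := omega_trajectory; have [_ S0 _] := S_semigroup.
by exists u; rewrite -(S0 u); exact: uL.
Qed.

End semigroup_dynamics.

Section pairing.
Context {R : realType} {W : normedModType R}.

Lemma dual_eval_le (f : dual W) (w : W) : `|f w| <= `|f| * `|w|.
Proof.
have [->|w0] := eqVneq w 0.
  by rewrite (linear0 (f : {linear W -> R^o})) !normr0 mulr0.
have := @dual_norm_ub _ _ f (`|w|^-1 *: w).
rewrite normrZ normfV normr_id mulVf ?normr_eq0// => /(_ (lexx _)).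
rewrite (linearZ_LR (f : {linear W -> R^o}))/= normrM normfV normr_id.
by rewrite mulrC ler_pdivrMr ?normr_gt0.
Qed.

Lemma dual_eval_continuous (w : W) : continuous (fun f : dual W => f w : R).
Proof.
move=> f U /nbhs_ballP[e /= e0 eU].
apply/nbhs_ballP; exists (e / (`|w| + 1)); first by rewrite /= divr_gt0// ltr_wpDl.
move=> g; rewrite -ball_normE/= => fg; apply: eU; rewrite -ball_normE/=.
rewrite -[_ - _]/((f - g) w) (le_lt_trans (dual_eval_le _ _))//.
rewrite (@le_lt_trans _ _ (`|f - g| * (`|w| + 1)))//.
  by rewrite ler_wpM2l// lerDl.
by rewrite -ltr_pdivlMr// ltr_wpDl.
Qed.

Lemma continuous_pairing (T : topologicalType) (f : T -> dual W) (w : W) :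
  continuous f -> continuous (fun x => f x w : R).
Proof.
move=> cf x.
apply: (@continuous_comp _ _ _ f (fun g : dual W => g w : R)); first exact: cf.
exact: dual_eval_continuous.
Qed.

Lemma continuous_row (T : topologicalType) m (f : 'I_m -> T -> R) :
  (forall j, continuous (f j)) -> continuous (fun x => \row_j f j x).
Proof.
move=> cf x; apply/cvgrPdist_le => e e0.
near=> y.
rewrite /Num.Def.normr/= mx_normrE (bigmax_le _ (ltW e0))//= => -[i j] _.
rewrite !mxE/=.
move: j; near: y; apply: filter_forall => j.
by have /cvgrPdist_le := cf j x; apply.
Unshelve. all: by end_near. Qed.

Lemma cyl_derivE_sum (Psi : cyl W) (u f : dual W) :
  f (cyl_deriv Psi u) = \sum_j f (cyl_dir j) *
    'D_(delta_mx 0 j) (@cyl_prof _ _ Psi) (cyl_coord Psi u).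
Proof.
have [dpsi _ _] := cyl_profP Psi.
rewrite cyl_deriv_row derive_row_sum//; apply: eq_bigr => j _.
by rewrite mxE.
Qed.

Lemma cyl_pairing_continuous (T : topologicalType) (Psi : cyl W)
    (u f : T -> dual W) : continuous u -> continuous f ->
  continuous (fun x => f x (cyl_deriv Psi (u x)) : R).
Proof.
have [_ cpsi _] := cyl_profP Psi.
move=> cu cf; rewrite (_ : (fun x => _) = fun x => \sum_j f x (cyl_dir j) *
  'D_(delta_mx 0 j) (@cyl_prof _ _ Psi) (cyl_coord Psi (u x))); last first.
  by apply/funext => x; exact: cyl_derivE_sum.
apply: continuous_sumr => j; apply: continuous_mulr.
  exact: continuous_pairing.
have ccoord : continuous (fun x => cyl_coord Psi (u x)).
  by apply: continuous_row => i; exact: continuous_pairing.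
move=> x; apply: (@continuous_comp _ _ _ (fun x => cyl_coord Psi (u x))
  ('D_(delta_mx 0 j) (@cyl_prof _ _ Psi))); first exact: ccoord.
exact: cpsi.
Qed.

End pairing.

(** * Test functionals along trajectories *)

Section no_descent.
Context {R : realType} {X : topologicalType} {W : normedModType R}.
Variables (iota F : X -> dual W) (S : R -> X -> X) (L : set X).
Hypotheses (iota_cont : continuous iota) (S_assoc : associated_semigroup iota F S)
  (L_compact : compact L).

Lemma associated_is_derive (u : X) (w : W) (t : R) : 0 < t ->
  is_derive t 1 (fun s => iota (S s u) w : R) (F (S t u) w).
Proof.
move=> t0; have [/(_ t (ltW t0)) dS _] := S_assoc u w.
have E : h^-1 *: ((iota (S (h *: 1 + t) u) w : R) - iota (S t u) w) @[h --> 0^'] -->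
   (F (S t u) w : R).
  apply/cvgrPdist_le => e e0.
  have /cvgrPdist_le/(_ e e0) dSe := dS.
  have /nbhs_ballP[r /= r0 rP] : \forall s \near t, s != t -> `[0, +oo[%classic s ->
      `|F (S t u) w - (s - t)^-1 * (iota (S s u) w - iota (S t u) w)| <= e.
    exact: dSe.
  near=> h.
  have h0 : h != 0 by near: h; exact: nbhs_dnbhs_neq.
  (* The bound by [t] keeps [h + t] positive, so that the quotients taken within [0, +oo[ include
     this one. *)
  have hr : `|h| < Num.min r t by near: h; apply: dnbhs0_lt; rewrite lt_min r0.
  move: hr; rewrite lt_min => /andP[hr ht].
  have := rP (h + t); rewrite -ball_normE/= opprD addrCA subrr addr0 normrN.
  move=> /(_ hr); rewrite -[X in _ != X]add0r (inj_eq (addIr t)) => /(_ h0).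
  rewrite in_itv/= andbT addrK -[_ *: _]/(_ * _) -[h *: 1]/(h * 1) mulr1; apply.
  by move: ht; rewrite ltr_norml => /andP[? _]; lra.
by apply: DeriveDef; [apply/cvg_ex; eexists; exact: E|exact: cvg_lim E].
Unshelve. all: by end_near. Qed.

Lemma cyl_trajectory_is_derive (Psi : cyl W) (u : X) (t : R) : 0 < t ->
  is_derive t 1 (fun s => cyl_fun Psi (iota (S s u)))
    (F (S t u) (cyl_deriv Psi (iota (S t u)))).
Proof.
move=> t0; pose g (s : R) : 'rV[R]_(cyl_dim Psi) := cyl_coord Psi (iota (S s u)).
have dj j := associated_is_derive u (@cyl_dir _ _ Psi j) t0.
have dg : derivable g t 1.
  apply/derivable_mxP => i j; rewrite (_ : (fun _ => _) =
    fun s => iota (S s u) (@cyl_dir _ _ Psi j)); first by have [] := dj j.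
  by apply/funext => s; rewrite mxE.
have Dg : 'D_1 g t = pairing_row (@cyl_dir _ _ Psi) (F (S t u)).
  rewrite derive_mx//; apply/matrixP => i j; rewrite !mxE.
  rewrite (_ : (fun _ => _) = fun s => iota (S s u) (@cyl_dir _ _ Psi j)).
    by have [_ ->] := dj j.
  by apply/funext => s; rewrite mxE.
have [dpsi _ _] := cyl_profP Psi.
have dpg : differentiable (@cyl_prof _ _ Psi \o g) t.
  by apply: differentiable_comp => //; exact/derivable1_diffP.
apply: DeriveDef; first exact/derivable1_diffP.
rewrite -[fun s => _]/(@cyl_prof _ _ Psi \o g) deriveE// diff_comp//=; last first.
  exact/derivable1_diffP.
have dgd : differentiable g t by exact/derivable1_diffP.
by rewrite -(deriveE (1 : R) dgd) Dg -deriveE// cyl_deriv_row.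
Qed.

(** If the pairing were at most - e on [L], the functional would fall by at least e (T - 1) between
    times 1 and T, more than its range within [- M, M] allows. *)
Lemma cyl_pairing_not_negative (Psi : cyl W) (u : X) (e : R) :
  (forall t, 0 <= t -> L (S t u)) -> 0 < e ->
  exists2 v, L v & - e < F v (cyl_deriv Psi (iota v)).
Proof.
move=> uL e0; apply: contrapT => neg.
have Fe v : L v -> F v (cyl_deriv Psi (iota v)) <= - e.
  by move=> Lv; rewrite leNgt; apply/negP => Fv; apply: neg; exists v.
have [M M0 Mg] : exists2 M, 0 <= M &
    forall t, 0 <= t -> `|cyl_fun Psi (iota (S t u))| <= M.
  have cg : continuous (fun v => cyl_fun Psi (iota v)).
    have ccoord : continuous (fun v => cyl_coord Psi (iota v)).
      by apply: continuous_row => i; exact: continuous_pairing.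
    have [dpsi _ _] := cyl_profP Psi.
    move=> v; apply: (@continuous_comp _ _ _ (fun v => cyl_coord Psi (iota v))
      (@cyl_prof _ _ Psi)); first exact: ccoord.
    exact: differentiable_continuous.
  have /compact_bounded[M [_ /(_ (`|M| + 1))]] :
      compact ((fun v => cyl_fun Psi (iota v)) @` L).
    by apply: continuous_compact => //; apply: continuous_subspaceT => v; exact: cg.
  rewrite ltr_pwDr// ?ler_norm// => /(_ isT) LM; exists (`|M| + 1).
    by rewrite addr_ge0.
  by move=> t t0; apply: LM; exists (S t u) => //; exact: uL.
pose g t := cyl_fun Psi (iota (S t u)).
(* Chosen so that e (T - 1) = e + 2 M. The interval starts at 1 because two-sided derivatives are
   available only at positive times. *)
pose T := 2 + (2 * M) / e.
have T1 : 1 < T by rewrite /T ltr_wpDr// ?divr_ge0 ?mulr_ge0// ?ltW// ltr1n.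
have pos (x : R) : 1 <= x -> 0 < x by apply: lt_le_trans.
have [||c] := @MVT R g (fun t => F (S t u) (cyl_deriv Psi (iota (S t u)))) 1 T T1.
- by move=> x; rewrite in_itv/= => /andP[/ltW/pos x1 _]; exact: cyl_trajectory_is_derive.
- apply: derivable_within_continuous => x; rewrite in_itv/= => /andP[/pos x1 _].
  by have [] := cyl_trajectory_is_derive Psi u x1.
rewrite in_itv/= => /andP[/ltW/pos/ltW c0 _] gE.
have := Fe _ (uL _ c0).
have := Mg 1 ler01; have := Mg T (ltW (pos _ (ltW T1))).
rewrite -!/(g _) !ler_norml => /andP[? ?] /andP[? ?] Fc.
have Te : e * (T - 1) = e + 2 * M.
  by rewrite /T; field; rewrite gt_eqF.
nra.
Qed.

End no_descent.

(** * The variational principle *)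

Section borel_integrals.
Context {R : realType} {X : ptopologicalType}.
Implicit Types (L : set X) (f : X -> R) (mu : probability (borel X) R).

Lemma borel_open (U : set X) : open U -> measurable (U : set (borel X)).
Proof. by move=> oU; exact: sub_gen_smallest. Qed.

Lemma borel_closed (A : set X) : closed A -> measurable (A : set (borel X)).
Proof.
move=> cA; rewrite -(setCK A); apply: measurableC.
by apply: borel_open; exact: closed_openC.
Qed.

Lemma borel_measurable_fun d (T : measurableType d) (f : T -> borel X) :
  (forall U : set X, open U -> measurable (f @^-1` U)) ->
  measurable_fun [set: T] f.
Proof.
move=> mf; have := @measurability _ _ T (borel X) setT f (@open X) erefl.
by apply => _ [U oU <-]; rewrite setTI; exact: mf.
Qed.

Lemma within_continuous_measurable L f : closed L -> {within L, continuous f} ->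
  measurable_fun (L : set (borel X)) (f : borel X -> R).
Proof.
move=> cL cf; apply: open_preimage_measurable_fun => U oU.
have /open_subspaceP[V oV] : open (f @^-1` U : set (subspace L)).
  by apply: open_comp => // x _; exact: cf.
rewrite (setIC L) => <-; apply: measurableI; last exact: borel_closed.
exact: borel_open.
Qed.

Lemma compact_within_bounded L f : compact L -> {within L, continuous f} ->
  [bounded f u | u in L].
Proof.
move=> cL cf; have [M [Mr fM]] : bounded_set (f @` L).
  by apply: compact_bounded; exact: continuous_compact.
by exists M; split => // N MN u Lu; apply: (fM _ MN); exists u.
Qed.

Lemma within_continuous_integrable mu L f : closed L ->
  {within L, continuous f} -> [bounded f u | u in L] ->
  mu.-integrable (L : set (borel X)) (EFin \o (f : borel X -> R)).
Proof.
move=> cL cf bf; apply: measurable_bounded_integrable => //.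
- exact: borel_closed.
- by rewrite (le_lt_trans (probability_le1 _ _)) ?ltry//; exact: borel_closed.
- exact: within_continuous_measurable.
Qed.

Lemma carried_by_setT L mu : closed L -> carried_by L mu -> mu L = 1%E.
Proof.
move=> cL muL; have mL := borel_closed cL.
have : mu [set: borel X] = 1%E by exact: probability_setT.
rewrite -(setUv (L : set (borel X))) measureU ?setICr//; last exact: measurableC.
by rewrite [X in (_ + X)%E](_ : _ = 0%E) ?adde0.
Qed.

Lemma carried_by_integral L mu (f : borel X -> \bar R) : closed L ->
  carried_by L mu -> mu.-integrable [set: borel X] f ->
  (\int[mu]_x f x = \int[mu]_(x in (L : set (borel X))) f x)%E.
Proof.
move=> cL muL intf.
rewrite (@negligible_integral _ _ _ mu setT (~` L))// ?setTD ?setCK//.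
by apply: measurableC; exact: borel_closed.
Qed.

Lemma carried_by_integrable L mu (f : borel X -> R) : closed L ->
  carried_by L mu -> measurable_fun [set: borel X] f ->
  [bounded f u | u in L] -> mu.-integrable [set: borel X] (EFin \o f).
Proof.
move=> cL muL mf bf; have mL := borel_closed cL.
apply/(@negligible_integrable _ _ _ mu setT (~` L)) => //.
- exact: measurableC.
- exact/measurable_EFinP.
rewrite setTD setCK; apply: measurable_bounded_integrable => //.
- by rewrite (le_lt_trans (probability_le1 _ _)) ?ltry.
- exact: measurable_funTS.
Qed.

End borel_integrals.

Lemma within_comp_continuous (R : realType) (T X : topologicalType) (A : set X)
    (q : T -> X) (g : X -> R) :
  continuous q -> (forall c, A (q c)) -> {within A, continuous g} ->
  continuous (g \o q).
Proof.
move=> cq qA /subspace_continuousP cg c U gU.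
have /cq : nbhs (q c) [set y | A y -> U (g y)] by exact: (cg (q c) (qA c)).
by apply: (@filterS _ (nbhs c)) => c' /(_ (qA c')).
Qed.

Lemma cantor_continuous_integrable (R : realType)
    (nu : probability (clopen_sigma cantor_space) R) (f : cantor_space -> R) :
  continuous f ->
  nu.-integrable [set: clopen_sigma cantor_space]
    (EFin \o (f : clopen_sigma cantor_space -> R)).
Proof.
move=> cf; have [M fM] := bfun_continuous cantor_space_compact cf.
apply: measurable_bounded_integrable => //.
- by rewrite (le_lt_trans (probability_le1 _ _)) ?ltry.
- apply: open_preimage_measurable_fun => U oU; rewrite setTI.
  by apply: cantor_open_measurable; apply: open_comp => // c _; exact: cf.
- exists M; split; first exact: num_real.
  by move=> N MN c _ /=; rewrite (le_trans (fM c))// ltW.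
Qed.

Section cantor_pushforward.
Context {R : realType} {X : ptopologicalType}.
Variables (L : set X) (pi : cantor_space -> X).
Hypotheses (L_closed : closed L) (pi_cont : continuous pi) (pi_range : range pi = L).
Implicit Types (f : X -> R) (nu : probability (clopen_sigma cantor_space) R).

Let piL c : L (pi c). Proof. by rewrite -pi_range; exists c. Qed.

Lemma pi_measurable :
  measurable_fun [set: clopen_sigma cantor_space] (pi : _ -> borel X).
Proof.
apply: borel_measurable_fun => U oU; apply: cantor_open_measurable.
by apply: open_comp => // c _; exact: pi_cont.
Qed.

Lemma cantor_pushforward nu : exists mu : probability (borel X) R,
  [/\ forall A : set (borel X), measurable A -> mu A = nu (pi @^-1` A),
      carried_by L mu &
      forall f, {within L, continuous f} ->
        \int[mu]_(u in L) f u = \int[nu]_c f (pi c)].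
Proof.
pose T := clopen_sigma cantor_space.
pose p : {mfun T >-> borel X} := HB.pack (pi : T -> borel X)
  (isMeasurableFun.Build _ _ _ _ _ pi_measurable).
exists (distribution nu p); split => //.
  rewrite /carried_by -[RHS](measure0 nu); congr (nu _).
  by apply/seteqP; split => c //=; apply; exact: piL.
move=> f cf; have mL := borel_closed L_closed.
rewrite Rintegral_mkcond /Rintegral; congr fine.
(* The values of [f] outside [L] are arbitrary; extension by zero makes it measurable on [X]. *)
have mf : measurable_fun [set: borel X] (f \_ L : borel X -> R).
  apply/(measurable_restrictT (f : borel X -> R) mL).
  exact: within_continuous_measurable.
have fE : (EFin \o (f \_ L)) \o pi = EFin \o (f \o pi).
  by apply/funext => c /=; rewrite patchE mem_set//; exact: piL.
rewrite integral_pushforward//=.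
- by apply: eq_integral => c _; rewrite /= -[LHS]/(((EFin \o (f \_ L)) \o pi) c) fE.
- exact: pi_measurable.
- exact/measurable_EFinP.
- rewrite preimage_setT [X in integrable _ _ X](_ : _ = EFin \o (f \o pi))//.
  by apply: cantor_continuous_integrable; exact: within_comp_continuous pi_cont piL cf.
Qed.

End cantor_pushforward.

(** * Duality between stationary measures and test functionals *)

Section lagrangian_duality.
Context {R : realType} {X : ptopologicalType} {W : normedModType R}.
Variables (iota F : X -> dual W) (L : set X) (pi : cantor_space -> X) (phi : X -> R).
Hypotheses (iota_cont : continuous iota)
  (F_borel : measurable_fun [set: borel X] (F : borel X -> borel (dual W)))
  (L_closed : closed L) (L_compact : compact L)
  (F_cont : {within L, continuous F}) (phi_cont : {within L, continuous phi})
  (pi_cont : continuous pi) (pi_range : range pi = L)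
  (no_descent : forall (Psi : cyl W) (e : R), 0 < e ->
     exists2 v, L v & - e < F v (cyl_deriv Psi (iota v))).

Let G (Psi : cyl W) (v : X) : R := F v (cyl_deriv Psi (iota v)).

Let piL c : L (pi c). Proof. by rewrite -pi_range; exists c. Qed.

Lemma generator_within_continuous Psi : {within L, continuous (G Psi)}.
Proof.
by apply: (@cyl_pairing_continuous R W (subspace L) Psi iota F) => //;
  exact: continuous_subspaceT.
Qed.

Lemma lagrangian_within_continuous Psi :
  {within L, continuous (lagrangian iota F phi Psi)}.
Proof.
apply: (@continuous_addr R (subspace L) phi (G Psi)); first exact: phi_cont.
exact: generator_within_continuous.
Qed.

Lemma lagrangian_max Psi : L !=set0 ->
  exists M, is_max [set lagrangian iota F phi Psi u | u in L] M.
Proof.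
move=> L0; have [c] := compact_EVT_max L0 L_compact (@lagrangian_within_continuous Psi).
rewrite inE => Lc cM; exists (lagrangian iota F phi Psi c); split; first by exists c.
by move=> _ [u Lu <-]; apply: cM; rewrite inE.
Qed.

Lemma iota_bounded (w : W) : exists M, forall u, (iota @` L) u -> `|u w| <= M.
Proof.
have cw : {within L, continuous (fun v => iota v w : R)}.
  by apply: continuous_subspaceT; exact: continuous_pairing.
have [M [Mr MP]] := compact_within_bounded L_compact cw.
by exists (M + 1) => _ [v Lv <-]; apply: MP => //; rewrite ltrDl.
Qed.

(** Expanding the derivative over finitely many directions separates [F], which is only Borel on
    [X], from coefficients that are continuous there. *)
Lemma cyl_pairing_measurable (Psi : cyl W) :
  measurable_fun [set: borel X] (G Psi : borel X -> R).
Proof.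
have [_ cpsi _] := cyl_profP Psi.
rewrite (_ : G Psi = fun v => \sum_j F v (cyl_dir j) *
  'D_(delta_mx 0 j) (@cyl_prof _ _ Psi) (cyl_coord Psi (iota v))); last first.
  by apply/funext => v; exact: cyl_derivE_sum.
apply: measurable_sum => j; apply: measurable_funM.
  apply: open_preimage_measurable_fun => U oU.
  pose V := (fun f : dual W => f (cyl_dir j) : R) @^-1` U.
  have mV : measurable (V : set (borel (dual W))).
    by apply: borel_open; apply: open_comp => // f _; exact: dual_eval_continuous.
  exact: (F_borel measurableT mV).
apply: open_preimage_measurable_fun => U oU; rewrite setTI; apply: borel_open.
apply: open_comp => // v _.
apply: (@continuous_comp _ _ _ (fun v => cyl_coord Psi (iota v))
  ('D_(delta_mx 0 j) (@cyl_prof _ _ Psi))); last exact: cpsi.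
by apply: continuous_row => i; exact: continuous_pairing.
Qed.

(** Weak duality: <F, Psi'> integrates to 0, so the Lagrangian may replace phi under the
    integral. *)
Lemma wsss_integral_le (mu : probability (borel X) R) Psi M :
  P_wsss iota F L mu -> is_max [set lagrangian iota F phi Psi u | u in L] M ->
  \int[mu]_(u in L) phi u <= M.
Proof.
move=> [ws muL] [_ Mub]; have mL := borel_closed L_closed.
have [intG G0] := ws Psi.
have intGL : mu.-integrable (L : set (borel X)) (EFin \o (G Psi : borel X -> R)).
  exact: integrableS intG.
have intphi := within_continuous_integrable mu L_closed phi_cont
  (compact_within_bounded L_compact phi_cont).
have GL : \int[mu]_(u in (L : set (borel X))) G Psi u = 0.
  by rewrite /Rintegral -(carried_by_integral L_closed muL intG) G0.
rewrite -[leLHS]addr0 -GL -RintegralD//.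
have -> : M = \int[mu]_(u in (L : set (borel X))) M.
  by rewrite Rintegral_cst// [X in fine X](carried_by_setT L_closed muL) mulr1.
apply: le_Rintegral => //.
- apply: (@within_continuous_integrable _ _ mu L (lagrangian iota F phi Psi)) => //.
    exact: lagrangian_within_continuous.
  by apply: compact_within_bounded => //; exact: lagrangian_within_continuous.
- by apply: (@within_continuous_integrable _ _ mu L (fun=> M)) => //;
    [exact: cst_continuous|apply: compact_within_bounded => //; exact: cst_continuous].
- by move=> u Lu; apply: Mub; exists u.
Qed.

Let E : set (R * (cantor_space -> R)) :=
  [set p | exists Psi, forall c, p.2 c + G Psi (pi c) <= p.1].

Lemma cyl_zero : exists Psi : cyl W, forall v, L v -> G Psi v = 0.
Proof.
have [Psi PsiP] := @cyl_realize R W (iota @` L) 0 (fun=> 0) (fun=> 0)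
  (C1_cst 0) (fun j => iota_bounded 0).
exists Psi => v Lv; rewrite /G PsiP ?derive_cst//; by exists v.
Qed.

Let E_le f a : (forall c, f c <= a) -> E (a, f).
Proof.
move=> fa; have [Psi Psi0] := cyl_zero; exists Psi => c /=.
by rewrite Psi0// addr0.
Qed.

Let E_cone : proper_cone E.
Proof.
split.
- by apply: E_le.
- move=> a f b g [Psi1 P1] [Psi2 P2].
  have [Psi PsiP] := cyl_add Psi1 Psi2 iota_bounded; exists Psi => c /=.
  have := P1 c; have := P2 c => /=; rewrite /G PsiP; last by exists (pi c).
  rewrite -[(f + g) c]/(f c + g c); lra.
- move=> t a f t0 [Psi1 P1].
  have [Psi PsiP] := cyl_scale t Psi1 iota_bounded; exists Psi => c /=.
  rewrite /G PsiP; last by exists (pi c).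
  by rewrite -[(t *: f) c]/(t * f c) -mulrDr ler_pM2l//; exact: P1.
(* Properness is [no_descent]: a negative [a] would be an upper bound of <F, Psi'> on [L]. *)
- move=> a [Psi P]; rewrite leNgt; apply/negP => a0.
  have [|v] := @no_descent Psi (- a); first by rewrite oppr_gt0.
  rewrite -pi_range => -[c _ <-]; rewrite opprK.
  by have := P c; rewrite /= -[0 c]/(0 : R) add0r /G leNgt => /negP.
Qed.

Lemma lagrangian_duality (v : R) :
  is_inf [set M : R | exists Psi : cyl W,
    is_max [set lagrangian iota F phi Psi u | u in L] M] v ->
  is_max [set \int[mu]_(u in L) phi u | mu in P_wsss iota F L] v.
Proof.
move=> [vlb vglb].
have L0 : L !=set0 by exists (pi point).
have Einf : infimums [set a | E (a, phi \o pi)] v.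
  split.
    move=> a [Psi /= Psia]; have [M MP] := lagrangian_max Psi L0.
    apply: (@le_trans _ _ M); first by apply: vlb; exists Psi.
    have [[u]] := MP; rewrite -{1}pi_range => -[c _ <-] <- _; exact: Psia.
  move=> l lE; apply: vglb => M [Psi [_ MP]]; apply: lE; exists Psi => c /=.
  by apply: MP; exists (pi c).
have [nu [nuphi nuE]] := cone_measure E_cone E_le
  (within_comp_continuous pi_cont piL phi_cont) Einf.
have [mu [_ muL muP]] := cantor_pushforward L_closed pi_cont pi_range nu.
have mu_int : \int[mu]_(u in L) phi u = v by rewrite muP.
split; last first.
  move=> _ [mu' wmu' <-]; apply: vglb => M [Psi MP].
  exact: wsss_integral_le MP.
exists mu => //; split => // Psi.
have cG := @generator_within_continuous Psi.
have intG : mu.-integrable [set: borel X] (EFin \o (G Psi : borel X -> R)).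
  apply: (carried_by_integrable L_closed muL).
    exact: cyl_pairing_measurable.
  exact: compact_within_bounded.
split => //; rewrite (carried_by_integral L_closed muL intG).
have cGpi := within_comp_continuous pi_cont piL cG.
(* At level 0 the cone contains <F, Psi'>, by the test functional - Psi, and - <F, Psi'>, by Psi
   itself; so both integrals are at most 0. *)
have G0 : \int[mu]_(u in L) G Psi u = 0.
  rewrite muP//; apply/eqP; rewrite eq_le; apply/andP; split.
    apply: nuE => //.
    have [Psi' P'] := cyl_scale (-1) Psi iota_bounded; exists Psi' => c /=.
    by rewrite {2}/G P' ?mulN1r ?subrr//; exists (pi c).
  have cNG : {within L, continuous (fun u => -1 * G Psi u)}.
    by apply: (@continuous_mulr R (subspace L) (fun=> -1)) => //;
      exact: cst_continuous.
  rewrite -oppr_le0 -muP// -mulN1r -RintegralZl//; first last.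
  - by apply: integrableS intG => //; exact: borel_closed.
  - exact: borel_closed.
  rewrite muP//; apply: nuE; first exact: within_comp_continuous pi_cont piL cNG.
  by exists Psi => c /=; rewrite mulN1r addNr.
rewrite -[LHS]fineK; first by congr EFin; exact: G0.
apply: integrable_fin_num; first exact: borel_closed.
by apply: integrableS intG => //; exact: borel_closed.
Qed.

End lagrangian_duality.

(** * Time averages and invariant measures *)

Section time_integral.
Context {R : realType}.
Implicit Types (h g H : R -> R).

Definition time_int h (T : R) : R := \int[lebesgue_measure]_(t in `[0, T]) h t.

Definition time_avg h (T : R) : R := T^-1 * time_int h T.

Lemma continuous_integrable_itv h (a b : R) : continuous h ->
  lebesgue_measure.-integrable `[a, b] (EFin \o h).
Proof.
move=> ch; apply: continuous_compact_integrable; first exact: segment_compact.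
exact: continuous_subspaceT.
Qed.

Lemma time_int_FTC h H (T : R) : continuous h -> 0 <= T ->
  (forall x : R, 0 <= x -> is_derive x 1 H (h x)) -> time_int h T = H T - H 0.
Proof.
move=> ch; rewrite le_eqVlt => /predU1P[<- _|T0 HP].
  by rewrite /time_int set_itv1 Rintegral_set1 subrr.
have cH (x : R) : 0 <= x -> {for x, continuous H}.
  move=> x0; apply/differentiable_continuous/derivable1_diffP.
  by have [] := HP x x0.
rewrite /time_int /Rintegral (@continuous_FTC2 _ h H 0 T)//.
- exact: continuous_subspaceT.
- split.
  + by move=> x; rewrite in_itv/= => /andP[/ltW/HP[]].
  + exact/cvg_at_right_filter/cH.
  + exact/cvg_at_left_filter/cH/ltW.
- move=> x; rewrite in_itv/= => /andP[/ltW x0 _].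
  by rewrite derive1E; have [] := HP x x0.
Qed.

Lemma time_int_antiderivative h : continuous h ->
  exists H, forall x : R, 0 <= x -> is_derive x 1 H (h x).
Proof.
(* Integrating from -1 puts every x >= 0 to the right of the lower endpoint, so that the derivative
   at 0 is two-sided as well. *)
move=> ch; exists (fun x => \int[lebesgue_measure]_(t in `[-1, x]) h t) => x x0.
have [||||d D] := @continuous_FTC1_closed R h (-1) x (x + 1).
- by rewrite ltrDl.
- exact: continuous_integrable_itv.
- by rewrite (lt_le_trans _ x0).
- exact: ch.
by apply: DeriveDef => //; rewrite -derive1E.
Qed.

Lemma time_intD h g (T : R) : continuous h -> continuous g ->
  time_int (fun t => h t + g t) T = time_int h T + time_int g T.
Proof. by move=> ch cg; apply: RintegralD => //; exact: continuous_integrable_itv. Qed.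

Lemma time_intZ a h (T : R) : continuous h ->
  time_int (fun t => a * h t) T = a * time_int h T.
Proof. by move=> ch; apply: RintegralZl => //; exact: continuous_integrable_itv. Qed.

Lemma time_int_le h g (T : R) : continuous h -> continuous g ->
  (forall t, 0 <= t -> h t <= g t) -> time_int h T <= time_int g T.
Proof.
move=> ch cg hg; apply: le_Rintegral => //; [exact: continuous_integrable_itv..|].
by move=> t /=; rewrite in_itv/= => /andP[/hg].
Qed.

Lemma time_int_cst (a T : R) : 0 <= T -> time_int (fun=> a) T = a * T.
Proof.
move=> T0; have D (x : R) : 0 <= x -> is_derive x 1 (fun t => a * t) a.
  by move=> _; apply: is_derive_eq; rewrite -[LHS]/(a * 1) mulr1.
by rewrite (time_int_FTC _ T0 D) ?mulr0 ?subr0//; exact: cst_continuous.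
Qed.

Lemma time_int_shift h (s T : R) : continuous h -> 0 <= s -> 0 <= T ->
  time_int (fun t => h (t + s)) T = time_int h (T + s) - time_int h s.
Proof.
move=> ch s0 T0; have [H HP] := time_int_antiderivative ch.
have csh : continuous (fun t => h (t + s)).
  move=> t; apply: continuous_comp; last exact: ch.
  by apply: cvgD; [exact: cvg_id|exact: cvg_cst].
have D (x : R) : 0 <= x -> is_derive x 1 (fun t => H (t + s)) (h (x + s)).
  move=> x0; have [d D] := HP (x + s) (addr_ge0 x0 s0).
  have E : (fun z => z^-1 *: (H ((z *: 1 + x) + s) - H (x + s))) =
      (fun z : R => z^-1 *: (H (z *: 1 + (x + s)) - H (x + s))).
    by apply/funext => z; rewrite addrA.
  by apply: DeriveDef; [rewrite /derivable E|rewrite /derive E].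
rewrite (time_int_FTC csh T0 D) (time_int_FTC ch (addr_ge0 T0 s0) HP).
by rewrite (time_int_FTC ch s0 HP) add0r; lra.
Qed.

Lemma time_avg_ge h (M b e T0 : R) : continuous h -> 0 < e ->
  (forall t, 0 <= t -> `|h t| <= M) -> (forall t, T0 <= t -> b <= h t) ->
  \forall T \near +oo, b - e <= time_avg h T.
Proof.
move=> ch e0 hM hb.
have [H HP] := time_int_antiderivative ch.
pose t0 := Num.max 0 T0.
have t00 : 0 <= t0 by rewrite le_max lexx.
have cH (x : R) : 0 <= x -> {for x, continuous H}.
  move=> x0; apply/differentiable_continuous/derivable1_diffP.
  by have [] := HP x x0.
(* The integral up to T is at least b T + C, so the initial stretch is absorbed once |C| <= e T. *)
pose C := H t0 - H 0 - b * t0.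
near=> T.
have Tt0 : t0 < T by near: T; apply: nbhs_pinfty_gt; exact: num_real.
have T_gt0 : 0 < T by exact: le_lt_trans Tt0.
have CT : `|C| / e <= T by near: T; apply: nbhs_pinfty_ge; exact: num_real.
have [||c] := @MVT R H h t0 T Tt0.
- by move=> x; rewrite in_itv/= => /andP[/ltW tx _]; apply: HP; exact: le_trans tx.
- by apply: continuous_in_subspaceT => x /[!inE]/=; rewrite in_itv/= => /andP[tx _];
    apply: cH; exact: le_trans tx.
rewrite in_itv/= => /andP[t0c _] HE.
have bc : b <= h c.
  by apply: hb; rewrite ltW// (le_lt_trans _ t0c)// le_max lexx orbT.
rewrite /time_avg (time_int_FTC ch (ltW T_gt0) HP) mulrC ler_pdivlMr//.
have : b * (T - t0) <= H T - H t0 by rewrite HE ler_wpM2r// subr_ge0 ltW.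
have : `|C| <= T * e by rewrite -ler_pdivrMr.
have : - `|C| <= C by rewrite lerNl -normrN ler_norm.
rewrite /C; lra.
Unshelve. all: by end_near. Qed.

Lemma time_avgD h g (T : R) : continuous h -> continuous g ->
  time_avg (fun t => h t + g t) T = time_avg h T + time_avg g T.
Proof. by move=> ch cg; rewrite /time_avg time_intD// mulrDr. Qed.

Lemma time_avgZ a h (T : R) : continuous h ->
  time_avg (fun t => a * h t) T = a * time_avg h T.
Proof. by move=> ch; rewrite /time_avg time_intZ// mulrCA. Qed.

Lemma time_avg_cst (a T : R) : 0 < T -> time_avg (fun=> a) T = a.
Proof.
by move=> T0; rewrite /time_avg time_int_cst 1?ltW// mulrC mulfK// gt_eqF.
Qed.

Lemma time_avg_mono h g (T : R) : 0 < T -> continuous h -> continuous g ->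
  (forall t, 0 <= t -> h t <= g t) -> time_avg h T <= time_avg g T.
Proof.
move=> T0 ch cg hg; rewrite /time_avg ler_pM2l ?invr_gt0//.
exact: time_int_le.
Qed.

Lemma time_avg_shift h (M s e : R) : continuous h -> 0 <= s -> 0 < e ->
  (forall t, 0 <= t -> `|h t| <= M) ->
  \forall T \near +oo, time_avg (fun t => h (t + s)) T - time_avg h T <= e.
Proof.
move=> ch s0 e0 hM.
have csh c : continuous (fun t => h (t + c)).
  move=> t; apply: continuous_comp; last exact: ch.
  by apply: cvgD; [exact: cvg_id|exact: cvg_cst].
have bound c T : 0 <= c -> 0 <= T ->
    - (M * T) <= time_int (fun t => h (t + c)) T <= M * T.
  move=> c0 T0; rewrite -mulNr -!time_int_cst//; apply/andP; split.
    apply: time_int_le => // [|t t0]; first exact: cst_continuous.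
    by have := hM _ (addr_ge0 t0 c0); rewrite ler_norml => /andP[].
  apply: time_int_le => // [|t t0]; first exact: cst_continuous.
  by have := hM _ (addr_ge0 t0 c0); rewrite ler_norml => /andP[].
near=> T.
have T0 : 0 < T by near: T; exact: nbhs_pinfty_gt.
have MT : 2 * M * s / e <= T by near: T; apply: nbhs_pinfty_ge; exact: num_real.
(* The two integrals differ by the integral over [T, T + s] minus that over [0, s], hence by at most
   2 M s. *)
rewrite /time_avg -mulrBr mulrC ler_pdivrMr// (time_int_shift ch s0 (ltW T0)).
have : 2 * M * s <= T * e by rewrite -ler_pdivrMr.
have := bound T s (ltW T0) s0; rewrite (time_int_shift ch (ltW T0) s0) => /andP[_].
have := bound 0 s (lexx _) s0; rewrite (_ : (fun t => h (t + 0)) = h); last first.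
  by apply/funext => t; rewrite addr0.
by move=> /andP[+ _]; rewrite (addrC s T); lra.
Unshelve. all: by end_near. Qed.

End time_integral.

(** * Comparing image measures through continuous functions on a normal set *)

Section measure_determining.
Context {R : realType} {X : ptopologicalType}.
Variables (B : set X) (nu : probability (clopen_sigma cantor_space) R)
  (p s : cantor_space -> X).
Hypotheses (X_hausdorff : hausdorff_space X) (B_normal : normal_space (set_type B))
  (p_cont : continuous p) (s_cont : continuous s)
  (pB : forall c, B (p c)) (sB : forall c, B (s c)).

(** Urysohn's lemma on the normal space [B], for the traces of [C] and of the complement of [U]; [C]
    is closed because [X] is Hausdorff. *)
Lemma normal_bump (C U : set X) : compact C -> open U -> C `<=` U ->
  exists g : X -> R, [/\ {within B, continuous g},
    forall x, B x -> 0 <= g x <= 1, forall x, B x -> C x -> g x = 1 &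
    forall x, B x -> ~ U x -> g x = 0].
Proof.
move=> cC oU CU.
pose v : set_type B -> X := set_val.
have cv : continuous v by exact: initial_continuous.
have c1 : closed (v @^-1` (~` U)).
  by apply: closed_comp => [x _|]; [exact: cv|exact: open_closedC].
have c2 : closed (v @^-1` C).
  by apply: closed_comp => [x _|]; [exact: cv|exact: compact_closed].
have [||f [cf f0 f1 f01]] := @urysohn_ext_itv _ R B_normal _ _ 0 1 c1 c2.
- by apply/seteqP; split => // x [/= nU /CU].
- exact: ltr01.
exists (valL f).
have fE x (Bx : B x) : valL f x = f (exist _ x (mem_set Bx)).
  by have /(congr1 (@^~ (exist _ x (mem_set Bx)))) := valLK point f.
split.
- exact/subspace_valL_continuousP.
- move=> x Bx; rewrite fE; have := f01 (f (exist _ x (mem_set Bx))).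
  by rewrite /= in_itv/=; apply; exists (exist _ x (mem_set Bx)).
- by move=> x Bx Cx; rewrite fE; apply: f1; exists (exist _ x (mem_set Bx)).
- by move=> x Bx Ux; rewrite fE; apply: f0; exists (exist _ x (mem_set Bx)).
Qed.

(** Let D be a clopen part of the preimage of [U] under [s]. Its image is compact, so a bump g equal
    to 1 there and to 0 off [U] bounds nu D by the integral of g after [s], which is that of g after
    [p], hence by the measure of the preimage under [p]. Such sets D exhaust the preimage. *)
Lemma open_measure_le (U : set X) :
  (forall g : X -> R, {within B, continuous g} ->
     (exists M, forall u, B u -> `|g u| <= M) ->
     \int[nu]_c g (s c) = \int[nu]_c g (p c)) ->
  open U -> (nu (s @^-1` U) <= nu (p @^-1` U))%E.
Proof.
move=> sp oU.
have mp : measurable (p @^-1` U : set (clopen_sigma cantor_space)).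
  by apply: cantor_open_measurable; apply: open_comp => // c _; exact: p_cont.
have osU : open (s @^-1` U) by apply: open_comp => // c _; exact: s_cont.
have step D : clopen D -> D `<=` s @^-1` U -> (nu D <= nu (p @^-1` U))%E.
  move=> cD DU.
  have mD : measurable (D : set (clopen_sigma cantor_space)) by exact: sub_gen_smallest.
  have cC : compact (s @` D).
    apply: continuous_compact.
      by apply: continuous_subspaceT => c; exact: s_cont.
    by apply: subclosed_compact cantor_space_compact _ => //; case: cD.
  have [|g [cg g01 g1 g0]] := normal_bump cC oU; first by move=> _ [c /DU ? <-].
  have gb : exists M, forall u, B u -> `|g u| <= M.
    by exists 1 => u /g01 /andP[? ?]; rewrite ger0_norm.
  have ints := cantor_continuous_integrable nu (within_comp_continuous s_cont sB cg).
  have intp := cantor_continuous_integrable nu (within_comp_continuous p_cont pB cg).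
  have E : (\int[nu]_c (g (s c))%:E = \int[nu]_c (g (p c))%:E)%E.
    rewrite -[LHS]fineK; last exact: integrable_fin_num ints.
    rewrite -[RHS]fineK; last exact: integrable_fin_num intp.
    by congr EFin; exact: (sp g cg gb).
  apply: (@le_trans _ _ (\int[nu]_c (g (s c))%:E)%E).
    have -> : nu D = (\int[nu]_c (\1_D c)%:E)%E by rewrite integral_indic ?setIT.
    apply: ge0_le_integral => //.
    - exact/measurable_EFinP/measurable_indic.
    - by case/integrableP: ints.
    - move=> c _; rewrite lee_fin indicE.
      have [/set_mem Dc|_] := boolP (c \in D); last by case/andP: (g01 _ (sB c)).
      by rewrite g1//; exists c.
  rewrite E.
  have -> : nu (p @^-1` U) = (\int[nu]_c (\1_(p @^-1` U) c)%:E)%E.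
    by rewrite integral_indic ?setIT.
  apply: ge0_le_integral => //.
  - by move=> c _; rewrite lee_fin; case/andP: (g01 _ (pB c)).
  - by case/integrableP: intp.
  - exact/measurable_EFinP/measurable_indic.
  - move=> c _; rewrite lee_fin indicE.
    have [/set_mem Uc|/negP Uc] := boolP (c \in _); first by case/andP: (g01 _ (pB c)).
    by rewrite g0// => Uc'; apply: Uc; rewrite inE.
have [D [cD UE]] := cantor_open_bigcup osU.
pose V n := \bigcup_(i < n) D i.
have cV n : clopen (V n).
  rewrite /V bigcup_mkord; elim: n => [|n IH]; first by rewrite big_ord0; exact: clopen0.
  by rewrite big_ord_recr; exact: clopenU.
have VE : s @^-1` U = \bigcup_n V n.
  rewrite UE; apply/seteqP; split => [c [n _ Dc]|c [n _ [i _ Dc]]].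
    by exists n.+1 => //; exists n => /=.
  by exists i.
have mV n : measurable (V n : set (clopen_sigma cantor_space)) by exact: sub_gen_smallest.
rewrite VE.
have cvgV : nu \o (V : nat -> set (clopen_sigma cantor_space)) @ \oo -->
    nu (\bigcup_n V n).
  apply: nondecreasing_cvg_mu => //; first exact: bigcupT_measurable.
  move=> m n mn; apply/subsetPset => c [i /= im Dc].
  by exists i => //=; exact: leq_trans mn.
rewrite -(cvg_lim _ cvgV)//; apply: lime_le; first by apply/cvg_ex; eexists; exact: cvgV.
apply: nearW => n /=; apply: step => // c Vc.
by rewrite VE; exists n.
Qed.

End measure_determining.

Lemma limf_esup_le (R : realType) (T : choiceType) (Y : filteredType T)
    (f : Y -> \bar R) (FF : set_system Y) (c : \bar R) :
  (\forall t \near FF, (f t <= c)%E) -> (limf_esup f FF <= c)%E.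
Proof.
move=> fc; rewrite limf_esupE.
apply: (@le_trans _ _ (ereal_sup (f @` [set t | (f t <= c)%E]))).
  by apply: ereal_inf_lbound; exists [set t | (f t <= c)%E].
by apply: ub_ereal_sup => _ [t ft <-].
Qed.

Lemma le_limf_esup_cst (R : realType) (c : \bar R) :
  (c <= limf_esup (fun _ : nat => c) \oo)%E.
Proof.
rewrite limf_esupE; apply: le_ereal_inf_tmp => _ [V /= [n _ nV] <-].
by apply: ereal_sup_ubound; exists n => //; apply: nV => /=.
Qed.

(** * Invariant measures from time averages along a trajectory *)

Section krylov_bogoliubov.
Context {R : realType} {X : ptopologicalType}.
Variables (S : R -> X -> X) (B K : set X) (pi : cantor_space -> X) (u0 : X).
Hypotheses (X_hausdorff : hausdorff_space X)
  (S_semigroup : continuous_semigroup S)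
  (B_invariant : positively_invariant S B)
  (B_closed : closed B) (B_normal : normal_space (set_type B))
  (K_compact : compact K) (K_attracts : attracts_points S K B)
  (pi_cont : continuous pi) (pi_range : range pi = B `&` K) (Bu0 : B u0).

Let L := B `&` K.

Let piL c : L (pi c). Proof. by rewrite /L -pi_range; exists c. Qed.

Let piB c : B (pi c). Proof. by case: (piL c). Qed.

Definition bounded_on (g : X -> R) : Prop := exists M, forall u, B u -> `|g u| <= M.

(** Holding the trajectory at its initial point for negative [t] gives a function continuous on the
    whole line, as the lemmas on [time_avg] require. *)
Definition along (g : X -> R) (u : X) (t : R) : R := g (S (Num.max 0 t) u).

Lemma limsup_time_averageE (g : X -> R) (u : X) : limsup_time_average S g u =
  limf_esup (fun T => (time_avg (along g u) T)%:E) +oo%R.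
Proof.
congr (limf_esup _ _); apply/funext => T; congr (_ * _)%:E.
by apply: eq_Rintegral => t; rewrite inE/= in_itv/= => /andP[t0 _]; rewrite /along max_r.
Qed.

Lemma along_continuous g u : B u -> {within B, continuous g} -> continuous (along g u).
Proof.
move=> Bu /subspace_continuousP cg t U gU.
have m0 (s : R) : 0 <= Num.max 0 s by rewrite le_max lexx.
have [V VS VU] : exists2 V, nbhs (S (Num.max 0 t) u) V & forall y, V y -> B y -> U (g y).
  exists [set y | B y -> U (g y)] => //.
  by exact: (cg _ (B_invariant (m0 t) Bu)).
have /subspace_continuousP cS := @trajectory_continuous _ _ _ S_semigroup u.
have : nbhs (Num.max 0 t) [set s | `[0, +oo[%classic s -> V (S s u)].
  by apply: (cS (Num.max 0 t)) => //=; rewrite in_itv/= m0.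
have cmax : {for t, continuous (fun s : R => Num.max 0 s)}.
  by apply: (@continuous_max _ _ (fun=> 0) id); [exact: cst_continuous|exact: cvg_id].
move=> /cmax; apply: (@filterS _ (nbhs t)) => s /= Vs.
apply: VU; first by apply: Vs; rewrite in_itv/= m0.
exact: B_invariant.
Qed.

Lemma along_bounded g u M : B u -> (forall v, B v -> `|g v| <= M) ->
  forall t, `|along g u t| <= M.
Proof. by move=> Bu gM t; apply/gM/B_invariant => //; rewrite le_max lexx. Qed.

(** The trajectory eventually stays where g > b - e / 2, a neighbourhood of [L] relative to [B]; the
    other e / 2 pays for the initial stretch. *)
Lemma along_near_ge g b e : {within B, continuous g} -> bounded_on g ->
  (forall u, L u -> b <= g u) -> 0 < e ->
  \forall T \near +oo, b - e <= time_avg (along g u0) T.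
Proof.
move=> cg [M gM] bg e0.
have /open_subspaceP[V oV VE] : open (g @^-1` [set y | b - e / 2 < y] : set (subspace B)).
  by apply: open_comp; [move=> x _; exact: cg|exact: open_gt].
have LV : L `<=` V.
  move=> u Lu; have : (g @^-1` [set y | b - e / 2 < y] `&` B) u.
    by split; [have := bg u Lu => /=; lra|case: Lu].
  by rewrite -VE => -[].
have [T0 [_ T0P]] := attracted B_invariant B_closed K_attracts Bu0 oV LV.
have -> : b - e = (b - e / 2) - e / 2 by lra.
apply: (@time_avg_ge R (along g u0) M (b - e / 2) (e / 2) (Num.max 0 T0 + 1)).
- exact: along_continuous.
- by lra.
- by move=> t _; exact: along_bounded.
- move=> t Tt; have : 0 <= Num.max 0 T0 by rewrite le_max lexx.
  have : T0 <= Num.max 0 T0 by rewrite le_max lexx orbT.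
  move=> h1 h2; have t0 : 0 <= t by lra.
  have Vt : V (S t u0) by apply: T0P; lra.
  have : (V `&` B) (S t u0) by split => //; exact: B_invariant.
  by rewrite VE /along max_r// => -[/ltW].
Qed.

(** The last clause says that the upper time average of [g] is at most [q.1]. *)
Let E : set (R * (cantor_space -> R)) :=
  [set q | exists g, [/\ {within B, continuous g}, bounded_on g,
     forall c, q.2 c <= g (pi c) &
     forall e, 0 < e -> \forall T \near +oo, time_avg (along g u0) T <= q.1 + e]].

Let E_le f a : (forall c, f c <= a) -> E (a, f).
Proof.
move=> fa; exists (fun=> a); split => //; first exact: cst_continuous.
  by exists `|a|.
move=> e e0; near=> T.
have T0 : 0 < T by near: T; exact: nbhs_pinfty_gt.
by rewrite (_ : along _ _ = fun=> a)// time_avg_cst// lerDl ltW.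
Unshelve. all: by end_near. Qed.

Let E_cone : proper_cone E.
Proof.
split.
- exact: E_le.
- move=> a f b g [f' [cf [M fM] ff' fa]] [g' [cg [N gN] gg' ga]].
  exists (fun u => f' u + g' u); split => /=.
  + exact: (@continuous_addr R (subspace B)).
  + by exists (M + N) => u Bu; rewrite (le_trans (ler_normD _ _))// lerD// ?fM ?gN.
  + by move=> c; rewrite -[(f + g) c]/(f c + g c) lerD// ?ff' ?gg'.
  + move=> e e0; have e2 : 0 < e / 2 by lra.
    near=> T; rewrite (_ : along _ _ = fun t => along f' u0 t + along g' u0 t)//.
    rewrite time_avgD; [|exact: along_continuous..].
    have : time_avg (along f' u0) T <= a + e / 2 by near: T; exact: fa.
    have : time_avg (along g' u0) T <= b + e / 2 by near: T; exact: ga.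
    lra.
- move=> t a f t0 [f' [cf [M fM] ff' fa]].
  exists (fun u => t * f' u); split => /=.
  + apply: (@continuous_mulr R (subspace B) (fun=> t)) => //; exact: cst_continuous.
  + by exists (`|t| * M) => u Bu; rewrite normrM ler_wpM2l// fM.
  + by move=> c; rewrite -[(t *: f) c]/(t * f c) ler_pM2l.
  + move=> e e0; have e2 : 0 < e / t by rewrite divr_gt0.
    near=> T; rewrite (_ : along _ _ = fun s => t * along f' u0 s)//.
    rewrite time_avgZ; last exact: along_continuous.
    have : time_avg (along f' u0) T <= a + e / t by near: T; exact: fa.
    by rewrite -(ler_pM2l t0) mulrDr (mulrC t (e / t)) divfK// gt_eqF.
- move=> a [g [cg bg g0 ga]]; rewrite leNgt; apply/negP => a0.
  (* With this margin some average would be at most 2 a / 3 and at least a / 3, absurd for a < 0. *)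
  have a2 : 0 < - a / 3 by lra.
  near (@pinfty_nbhs R) => T.
  have : time_avg (along g u0) T <= a + - a / 3 by near: T; exact: ga.
  have : 0 - (- a / 3) <= time_avg (along g u0) T.
    near: T; apply: along_near_ge => // u; rewrite /L -pi_range => -[c _ <-].
    exact: g0.
  lra.
Unshelve. all: by end_near. Qed.

(** A time shift is negligible in long averages. Used for g and - g, this membership will equate the
    integrals of g and of g after [S s]. *)
Let shift_in_E g s : {within B, continuous g} -> bounded_on g -> 0 <= s ->
  E (0, (fun c => g (S s (pi c)) - g (pi c))).
Proof.
move=> cg [M gM] s0.
have [_ _ SD] := S_semigroup.
have cgs : {within B, continuous (fun u => g (S s u))}.
  exact: (comp_semigroup_within_continuous S_semigroup B_invariant s0 cg).
exists (fun u => g (S s u) - g u); split => //=.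
- apply: (@continuous_addr R (subspace B) (fun u => g (S s u)) (fun u => - g u)) => //.
  move=> x; apply: cvgN; exact: cg.
- exists (M + M) => u Bu; rewrite (le_trans (ler_normB _ _))// lerD ?gM//.
  exact: B_invariant.
- move=> e e0; have cag := along_continuous Bu0 cg.
  near=> T.
  rewrite (_ : along _ _ =
    fun t => along (fun u => g (S s u)) u0 t + -1 * along g u0 t); last first.
    by apply/funext => t; rewrite mulN1r.
  have cagN : continuous (fun t => -1 * along g u0 t).
    by apply: continuous_mulr => //; exact: cst_continuous.
  rewrite time_avgD//; last exact: along_continuous.
  rewrite time_avgZ// mulN1r add0r.
  have -> : time_avg (along (fun u => g (S s u)) u0) T =
      time_avg (fun t => along g u0 (t + s)) T.
    rewrite /time_avg /time_int; congr (_ * _).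
    apply: eq_Rintegral => t; rewrite inE/= in_itv/= => /andP[t0 _].
    by rewrite /along !max_r ?addr_ge0// addrC SD.
  near: T; apply: (@time_avg_shift R _ M s e cag s0 e0) => t _.
  by apply: along_bounded Bu0 _ t.
Unshelve. all: by end_near. Qed.

Lemma krylov_bogoliubov (phi : X -> R) : {within B, continuous phi} ->
  bounded_on phi -> exists2 mu : probability (borel X) R, P_inv S L mu &
    (limsup_time_average S phi u0 <= (\int[mu]_(u in L) phi u)%:E)%E.
Proof.
move=> cphi bphi.
have LB : L `<=` B by move=> u [].
have cL (f : X -> R) : {within B, continuous f} -> {within L, continuous f}.
  exact: continuous_subspaceW.
have L_closed : closed L.
  by apply: closedI => //; exact: compact_closed.
pose A := [set a | E (a, phi \o pi)].
have hA : has_inf A.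
  have [M pM] := bphi; split.
    exists M; apply: E_le => c /=; exact: le_trans (ler_norm _) (pM _ (piB c)).
  exists (- M) => a Ea; have [_ addE _ posE] := E_cone.
  have : E (M, - (phi \o pi)).
    apply: E_le => c; rewrite -[(- (phi \o pi)) c]/(- phi (pi c)).
    by rewrite (le_trans (ler_norm _))// normrN pM.
  by move=> /(addE _ _ _ _ Ea); rewrite subrr => /posE; lra.
have infA : infimums A (inf A).
  by split; [move=> a Aa; apply: ge_inf => //; case: hA|
             move=> l lA; apply: lb_le_inf => //; case: hA].
have [nu [nuphi nuE]] := cone_measure E_cone E_le
  (within_comp_continuous pi_cont piB cphi) infA.
have [mu [muE muL muP]] := @cantor_pushforward R X L pi L_closed pi_cont pi_range nu.
exists mu; last first.
  rewrite muP; last exact: cL.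
  rewrite [X in (_ <= X%:E)%E](_ : _ = inf A)//.
  rewrite limsup_time_averageE; apply/lee_addgt0Pr => e e0; apply: limf_esup_le.
  (* One e / 3 is spent on a < inf A + e / 3, one on the averages of the majorant g, and one on
     [along_near_ge] for g - phi, which is nonnegative on [L]. *)
  have [|a Ea alt] := @inf_adherent _ A (e / 3) _ hA; first by lra.
  have [g [cg bg pg ga]] := Ea.
  have cgp : {within B, continuous (fun u => g u + -1 * phi u)}.
    apply: (@continuous_addr R (subspace B)); first exact: cg.
    by apply: (@continuous_mulr R (subspace B) (fun=> -1)) => //; exact: cst_continuous.
  have bgp : bounded_on (fun u => g u + -1 * phi u).
    have [M gM] := bg; have [N pN] := bphi; exists (M + N) => u Bu.
    by rewrite mulN1r (le_trans (ler_normB _ _))// lerD ?gM ?pN.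
  have gp0 u : L u -> 0 <= g u + -1 * phi u.
    by rewrite /L -pi_range => -[c _ <-]; have := pg c => /=; lra.
  have e3 : 0 < e / 3 by lra.
  near=> T.
  have h1 : time_avg (along g u0) T <= a + e / 3 by near: T; exact: ga.
  have h2 : 0 - e / 3 <= time_avg (along (fun u => g u + -1 * phi u) u0) T.
    by near: T; exact: along_near_ge.
  have cag := along_continuous Bu0 cg.
  have cap := along_continuous Bu0 cphi.
  move: h2; rewrite (_ : along _ _ = fun t => along g u0 t + -1 * along phi u0 t)//.
  rewrite time_avgD//; last by apply: continuous_mulr => //; exact: cst_continuous.
  rewrite time_avgZ// => h2.
  by rewrite -EFinD lee_fin; lra.
split => // t A' t0 mA'.
have mS : measurable_fun [set: borel X] (S t : borel X -> borel X).
  apply: borel_measurable_fun => U oU; apply: borel_open.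
  by apply: open_comp => // u _; exact: (semigroup_continuous S_semigroup).
have cSpi : continuous (fun c => S t (pi c)).
  move=> c; apply: (@continuous_comp _ _ _ pi (S t)); first exact: pi_cont.
  exact: semigroup_continuous.
have SpiB c : B (S t (pi c)) by exact: B_invariant.
have shift_le g : {within B, continuous g} -> bounded_on g ->
    \int[nu]_c g (S t (pi c)) <= \int[nu]_c g (pi c).
  move=> cg bg.
  have cgpi := within_comp_continuous pi_cont piB cg.
  have cgSpi := within_comp_continuous cSpi SpiB cg.
  rewrite -subr_le0 -RintegralB//; [|exact: cantor_continuous_integrable..].
  apply: nuE; last exact: shift_in_E.
  by move=> c; apply: cvgB; [exact: cgSpi|exact: cgpi].
have shift_eq g : {within B, continuous g} -> bounded_on g ->
    \int[nu]_c g (S t (pi c)) = \int[nu]_c g (pi c).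
  move=> cg bg; apply/eqP; rewrite eq_le shift_le//=.
  have cNg : {within B, continuous (fun u => -1 * g u)}.
    by apply: (@continuous_mulr R (subspace B) (fun=> -1)) => //; exact: cst_continuous.
  have bNg : bounded_on (fun u => -1 * g u).
    by have [M gM] := bg; exists M => u Bu; rewrite mulN1r normrN gM.
  have := shift_le _ cNg bNg.
  have cgpi := within_comp_continuous pi_cont piB cg.
  have cgSpi := within_comp_continuous cSpi SpiB cg.
  by rewrite !RintegralZl//; [lra|exact: cantor_continuous_integrable..].
pose St : {mfun borel X >-> borel X} := HB.pack (S t : borel X -> borel X)
  (isMeasurableFun.Build _ _ _ _ _ mS).
pose m1 : probability (borel X) R := distribution mu St.
rewrite -[LHS]/(m1 A').
(* Open sets are stable under intersection and generate the Borel sets; on them, each inequality is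
   one use of [open_measure_le], with the two maps into [B] exchanged. *)
apply: (@measure_unique _ R (borel X) (@open X) (fun=> setT)) => //.
- exact: openI.
- by move=> _; exact: openT.
- by apply/seteqP; split => // x _; exists 0%N.
- move=> U oU; rewrite /m1/= /distribution /pushforward.
  have mU := borel_open oU.
  have mSU : measurable (S t @^-1` U : set (borel X)).
    by apply: borel_open; apply: open_comp => // u _; exact: semigroup_continuous.
  rewrite !muE//; apply/eqP; rewrite eq_le; apply/andP; split.
    exact: (@open_measure_le R X B nu pi (fun c => S t (pi c))).
  apply: (@open_measure_le R X B nu (fun c => S t (pi c)) pi) => //.
  by move=> g cg bg; rewrite shift_eq.
- by move=> _; rewrite (le_lt_trans (probability_le1 _ _)) ?ltry.
Unshelve. all: by end_near. Qed.

End krylov_bogoliubov.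

(** * Riemann sums, in place of Fubini's theorem *)

Section riemann_sums.
Context {R : realType}.

(** Only [x] is confined to the interval: with [y] free, the property passes from two sets to their
    union, as [compact_local_ind] needs. *)
Lemma unif_continuous_itv (h : R -> R) (T e : R) : continuous h -> 0 < e ->
  exists2 d, 0 < d & forall x y, x \in `[0, T] -> `|x - y| < d -> `|h x - h y| <= e.
Proof.
move=> ch e0.
pose P (A : set R) := exists2 d, 0 < d &
  forall x y, A x -> `|x - y| < d -> `|h x - h y| <= e.
suff [d d0 dP] : P `[0, T]%classic by exists d.
apply: (@compact_local_ind R _ P); first exact: segment_compact.
- by exists 1.
- by move=> A B AB [d d0 dP]; exists d => // x y /AB; exact: dP.
- move=> A B [d d0 dP] [d' d'0 dP']; exists (Num.min d d'); first by rewrite lt_min d0.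
  by move=> x y [Ax|Bx]; rewrite lt_min => /andP[? ?]; [exact: dP|exact: dP'].
- move=> x _; have e2 : 0 < e / 2 by lra.
  have /nbhs_ballP[d /= d0 dP] : nbhs x (h @^-1` ball (h x) (e / 2)).
    by apply: ch; exact: nbhsx_ballx.
  exists (ball x (d / 2)); first by apply: nbhsx_ballx; rewrite divr_gt0.
  exists (d / 2); first by rewrite divr_gt0.
  move=> y z; rewrite -ball_normE/= => xy yz.
  have : `|h x - h y| < e / 2.
    by have := dP y; rewrite /preimage/= -!ball_normE/=; apply; lra.
  have : `|h x - h z| < e / 2.
    have := dP z; rewrite /preimage/= -!ball_normE/=; apply.
    by rewrite (le_lt_trans (ler_distD y _ _))//; lra.
  move=> hz hy; rewrite (le_trans (ler_distD (h x) _ _))// (distrC (h y)); lra.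
Qed.

Definition riemann_avg (h : R -> R) (T : R) (k : nat) : R :=
  k.+1%:R^-1 * \sum_(0 <= i < k.+1) h (i%:R * (T / k.+1%:R)).

(** Riemann sums involve finitely many times, so measurability in the initial point and invariance
    pass to time averages without joint measurability in time and space. *)
Lemma riemann_avg_cvg (h : R -> R) (T : R) : continuous h -> 0 < T ->
  riemann_avg h T k @[k --> \oo] --> time_avg h T.
Proof.
move=> ch T0; have [H HP] := time_int_antiderivative ch.
apply/cvgrPdist_le => e e0.
have [d d0 dP] := @unif_continuous_itv h T e ch e0.
near=> k.
have k0 : (0 : R) < k.+1%:R by [].
pose w := T / k.+1%:R.
have w0 : 0 < w by rewrite divr_gt0.
have wd : w < d.
  have : T / d < k.+1%:R.
    rewrite (@lt_trans _ _ k%:R) ?ltr_nat//; near: k; exact: nbhs_infty_gtr.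
  by rewrite /w !ltr_pdivrMr// mulrC.
have Tw : T = k.+1%:R * w by rewrite /w mulrC divfK// gt_eqF.
have step i : (i < k.+1)%N ->
    `|H (i.+1%:R * w) - H (i%:R * w) - h (i%:R * w) * w| <= e * w.
  move=> ik.
  have iw : i%:R * w < i.+1%:R * w by rewrite ltr_pM2r// ltr_nat.
  have iw0 : 0 <= i%:R * w by rewrite mulr_ge0// ltW.
  have [||c] := @MVT R H h _ _ iw.
  - by move=> x; rewrite in_itv/= => /andP[/ltW ix _]; apply: HP; exact: le_trans ix.
  - apply: derivable_within_continuous => x; rewrite in_itv/= => /andP[ix _].
    by have [] := HP x (le_trans iw0 ix).
  rewrite in_itv/= => /andP[ic ci] ->.
  have wE : i.+1%:R * w - i%:R * w = w by rewrite -mulrBl -natrB// subSnn mul1r.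
  rewrite wE -mulrBl normrM (gtr0_norm w0) ler_pM2r// distrC.
  apply: dP.
    rewrite in_itv/= iw0/= Tw ler_pM2r// ler_nat; exact: ltnW.
  rewrite distrC ger0_norm ?subr_ge0 ?ltW//.
  by rewrite (lt_trans _ wd)// ltrBlDr -ltrBlDl; lra.
have sumE : time_int h T = \sum_(0 <= i < k.+1) (H (i.+1%:R * w) - H (i%:R * w)).
  rewrite (telescope_sumr (fun i => H (i%:R * w)))// mul0r -Tw.
  by rewrite (time_int_FTC ch (ltW T0) HP).
have kT : k.+1%:R^-1 = T^-1 * w by rewrite /w mulKf// gt_eqF.
rewrite /time_avg /riemann_avg -/w kT -mulrA -mulrBr normrM gtr0_norm ?invr_gt0//.
rewrite mulrC ler_pdivrMr// sumE mulr_sumr -sumrB.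
apply: (le_trans (ler_norm_sum _ _ _)).
apply: (@le_trans _ _ (\sum_(0 <= i < k.+1) e * w)).
  rewrite !big_nat; apply: ler_sum => i /andP[_ ik].
  by rewrite (mulrC w); exact: step.
by rewrite sumr_const_nat subn0 -mulr_natl [in leRHS]Tw mulrCA.
Unshelve. all: by end_near. Qed.

End riemann_sums.

(** * Time averages under an invariant measure *)

Section invariant_averages.
Context {R : realType} {X : ptopologicalType}.
Variables (S : R -> X -> X) (B L : set X) (mu : probability (borel X) R) (phi : X -> R).
Hypotheses (S_semigroup : continuous_semigroup S)
  (B_invariant : positively_invariant S B) (B_closed : closed B)
  (L_closed : closed L) (LB : L `<=` B) (mu_inv : P_inv S L mu)
  (phi_cont : {within B, continuous phi}).
Variable M : R.
Hypothesis phi_bound : forall u, B u -> `|phi u| <= M.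

(** A negative bound would make [L] empty, although it has measure 1. *)
Let M0 : 0 <= M.
Proof.
have [_ muL] := mu_inv; rewrite leNgt; apply/negP => Mlt0.
have L0 : L = set0.
  by apply/seteqP; split => // u /LB/phi_bound; have := normr_ge0 (phi u); lra.
have := carried_by_setT L_closed muL; rewrite L0 measure0 => /eqP.
by rewrite eqe eq_sym oner_eq0.
Qed.

Let mL : measurable (L : set (borel X)). Proof. exact: borel_closed. Qed.

Let phi_t_cont t : 0 <= t -> {within L, continuous (fun u => phi (S t u))}.
Proof.
move=> t0; apply: (continuous_subspaceW LB).
exact: (comp_semigroup_within_continuous S_semigroup B_invariant t0 phi_cont).
Qed.

Let int_phi_t t : 0 <= t ->
  \int[mu]_(u in L) phi (S t u) = \int[mu]_(u in L) phi u.
Proof.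
move=> t0; have [inv muL] := mu_inv.
have mB : measurable (B : set (borel X)) by exact: borel_closed.
(* The extension by zero is from [B] and not from [L], since [S t] preserves [B] but may leave
   [L]. *)
pose f : borel X -> R := phi \_ B.
have mf : measurable_fun [set: borel X] f.
  apply/(measurable_restrictT (phi : borel X -> R) mB).
  exact: within_continuous_measurable.
have fE u : B u -> f u = phi u by move=> Bu; rewrite /f patchE mem_set.
have mS : measurable_fun [set: borel X] (S t : borel X -> borel X).
  apply: borel_measurable_fun => U oU; apply: borel_open.
  by apply: open_comp => // u _; exact: (semigroup_continuous S_semigroup).
pose St : {mfun borel X >-> borel X} := HB.pack (S t : borel X -> borel X)
  (isMeasurableFun.Build _ _ _ _ _ mS).
pose m1 : probability (borel X) R := distribution mu St.
have bf : [bounded f u | u in L].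
  exists M; split; first exact: num_real.
  by move=> N MN u /LB Bu; rewrite /= fE// (le_trans (phi_bound Bu))// ltW.
have bfS : [bounded f (S t u) | u in L].
  exists M; split; first exact: num_real.
  move=> N MN u /LB/(B_invariant t0) Bu; rewrite /= fE//.
  by rewrite (le_trans (phi_bound Bu))// ltW.
have intf := carried_by_integrable L_closed muL mf bf.
have mfS : measurable_fun [set: borel X] (f \o S t : borel X -> R).
  exact: measurableT_comp.
have intfS := carried_by_integrable L_closed muL mfS bfS.
transitivity (fine (\int[mu]_(u in (L : set (borel X))) ((f \o S t) u)%:E)%E).
  apply: eq_Rintegral => u; rewrite inE => Lu /=.
  by rewrite fE//; apply: B_invariant => //; exact: LB.
rewrite -(carried_by_integral L_closed muL intfS).
transitivity (fine (\int[m1]_u (f u)%:E)%E).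
  rewrite integral_pushforward//.
  exact/measurable_EFinP.
transitivity (fine (\int[mu]_u (f u)%:E)%E).
  congr fine; apply: eq_measure_integral => A mA _.
  exact: (inv t A t0 mA).
rewrite (carried_by_integral L_closed muL intf).
by apply: eq_Rintegral => u; rewrite inE => Lu; rewrite fE//; exact: LB.
Qed.

Let within_L_integrable f : {within L, continuous f} ->
  (forall u, L u -> `|f u| <= M) ->
  mu.-integrable (L : set (borel X)) (EFin \o (f : borel X -> R)).
Proof.
move=> cf fM; apply: within_continuous_integrable => //.
exists M; split; first exact: num_real.
by move=> N MN u Lu; rewrite /= (le_trans (fM u Lu))// ltW.
Qed.

Let riemann_cont T k : 0 < T ->
  {within L, continuous (fun u => riemann_avg (along S phi u) T k)}.
Proof.
move=> T0; apply: (@continuous_mulr R (subspace L) (fun=> k.+1%:R^-1)).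
  exact: cst_continuous.
apply: (@continuous_sumr R (subspace L)) => i.
by apply: (@phi_t_cont (Num.max 0 _)); rewrite le_max lexx.
Qed.

Let riemann_bound T k u : L u -> `|riemann_avg (along S phi u) T k| <= M.
Proof.
move=> /LB Bu; rewrite /riemann_avg normrM gtr0_norm ?invr_gt0//.
rewrite ler_pdivrMl//; apply: (le_trans (ler_norm_sum _ _ _)).
apply: (@le_trans _ _ (\sum_(0 <= i < k.+1) M)).
  by apply: ler_sum => i _; exact: (along_bounded B_invariant Bu phi_bound).
by rewrite sumr_const_nat subn0 -[leLHS]mulr_natl.
Qed.

Let int_riemann T k : 0 < T ->
  \int[mu]_(u in L) riemann_avg (along S phi u) T k = \int[mu]_(u in L) phi u.
Proof.
move=> T0; set v := RHS.
pose f i (u : borel X) : R := along S phi u (i%:R * (T / k.+1%:R)).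
have cf i : {within L, continuous (f i)}.
  by apply: phi_t_cont; rewrite le_max lexx.
have bf i u : L u -> `|f i u| <= M.
  by move=> /LB Bu; exact: (along_bounded B_invariant Bu phi_bound).
have intf n : mu.-integrable (L : set (borel X))
    (EFin \o (fun u => \sum_(0 <= i < n) f i u)).
  apply: within_continuous_integrable => //.
    exact: (@continuous_sumr R (subspace L)).
  exists (n%:R * M); split; first exact: num_real.
  move=> N MN u Lu; rewrite /= (le_trans _ (ltW MN))//.
  apply: (le_trans (ler_norm_sum _ _ _)).
  apply: (@le_trans _ _ (\sum_(0 <= i < n) M)); first by apply: ler_sum => i _; exact: bf.
  by rewrite sumr_const_nat subn0 -[leLHS]mulr_natl.
have intE n : \int[mu]_(u in L) (\sum_(0 <= i < n) f i u) = n%:R * v.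
  elim: n => [|n IH].
    rewrite mul0r -[RHS](mul0r (fine (mu L))) -Rintegral_cst//.
    by apply: eq_Rintegral => u _; rewrite big_geq.
  transitivity (\int[mu]_(u in L) (\sum_(0 <= i < n) f i u + f n u)).
    by apply: eq_Rintegral => u _; rewrite big_nat_recr.
  rewrite (RintegralD mL (intf n) (within_L_integrable (cf n) (bf n))).
  rewrite IH (_ : \int[mu]_(u in L) f n u = v).
    by rewrite -(natr1 n) mulrDl mul1r.
  by rewrite int_phi_t// le_max lexx.
rewrite /riemann_avg RintegralZl//.
by rewrite intE mulKf.
Qed.

Lemma time_avg_within_measurable T : 0 < T ->
  measurable_fun (L : set (borel X))
    ((fun u => time_avg (along S phi u) T) : borel X -> R).
Proof.
move=> T0; have := @measurable_fun_cvg _ (borel X) R (L : set (borel X))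
  (fun k (u : borel X) => riemann_avg (along S phi u) T k)
  (fun u => time_avg (along S phi u) T).
apply.
  by move=> k; apply: within_continuous_measurable => //; exact: riemann_cont.
move=> u /LB Bu; apply: riemann_avg_cvg => //.
exact: (along_continuous S_semigroup B_invariant Bu phi_cont).
Qed.

Lemma time_avg_bound T u : 0 < T -> L u -> `|time_avg (along S phi u) T| <= M.
Proof.
move=> T0 Lu; have Bu := LB Lu.
have ca := along_continuous S_semigroup B_invariant Bu phi_cont.
have aM t := along_bounded B_invariant Bu phi_bound t.
have cc (c : R) : continuous (fun _ : R => c) by exact: cst_continuous.
rewrite ler_norml -{1}(time_avg_cst (- M) T0) -[X in _ && (_ <= X)](time_avg_cst M T0).
apply/andP; split; apply: time_avg_mono => // t _;
  by have := aM t; rewrite ler_norml => /andP[].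
Qed.

Lemma invariant_integral_time_avg T : 0 < T ->
  (\int[mu]_(u in (L : set (borel X))) (time_avg (along S phi u) T)%:E =
   (\int[mu]_(u in L) phi u)%:E)%E.
Proof.
move=> T0.
have cvg1 : (\int[mu]_(u in (L : set (borel X))) (riemann_avg (along S phi u) T k)%:E)%E
    @[k --> \oo] -->
    (\int[mu]_(u in (L : set (borel X))) (time_avg (along S phi u) T)%:E)%E.
  apply: (@dominated_cvg _ _ _ mu (L : set (borel X)) mL _ _ (fun=> M%:E)) => //.
  - move=> k; apply/measurable_EFinP; apply: within_continuous_measurable => //.
    exact: riemann_cont.
  - move=> u Lu; apply: cvg_EFin; first exact: nearW.
    apply: riemann_avg_cvg => //.
    exact: (along_continuous S_semigroup B_invariant (LB Lu) phi_cont).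
  - apply: (@within_L_integrable (fun=> M)); first exact: cst_continuous.
    by move=> u _; rewrite ger0_norm.
  - by move=> k u Lu; rewrite lee_fin; exact: riemann_bound.
rewrite -(cvg_lim _ cvg1)//.
rewrite (_ : (fun n => _) = fun=> (\int[mu]_(u in L) phi u)%:E); first exact: lim_cst.
apply/funext => k; rewrite -(int_riemann k T0) /Rintegral fineK//.
apply: integrable_fin_num => //; apply: within_L_integrable; first exact: riemann_cont.
by move=> u; exact: riemann_bound.
Qed.

(* Reverse Fatou: if all limits superior were smaller than v, the averages,
   whose integrals are all equal to v, would have too small an integral. *)
Lemma invariant_limsup_ge :
  exists2 u, L u & ((\int[mu]_(u in L) phi u)%:E <= limsup_time_average S phi u)%E.
Proof.
have [_ muL] := mu_inv; have muL1 := carried_by_setT L_closed muL.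
set v := \int[mu]_(u in L) phi u.
apply: contrapT => noge.
have lt_v u : L u -> (limsup_time_average S phi u < v%:E)%E.
  by move=> Lu; rewrite ltNge; apply/negP => vu; apply: noge; exists u.
(* Fatou's lemma needs a sequence of times; [n.+1] keeps them positive. *)
pose a n (u : borel X) : R := time_avg (along S phi u) n.+1%:R.
have ma n : measurable_fun (L : set (borel X)) (a n) by exact: time_avg_within_measurable.
have aM n u : L u -> `|a n u| <= M by exact: time_avg_bound.
have inta n : mu.-integrable (L : set (borel X)) (EFin \o a n).
  apply: measurable_bounded_integrable => //.
    by rewrite (le_lt_trans (probability_le1 _ _)) ?ltry.
  exists M; split; first exact: num_real.
  by move=> N MN u Lu; rewrite /= (le_trans (aM n u Lu))// ltW.
have intM (c : R) : mu.-integrable (L : set (borel X)) (EFin \o (fun=> c)).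
  apply: within_continuous_integrable => //; first exact: cst_continuous.
  exists `|c|; split; first exact: num_real.
  by move=> N MN u Lu; rewrite /= ltW.
have intc (c : R) : (\int[mu]_(_ in (L : set (borel X))) c%:E = c%:E)%E.
  by rewrite integral_cst// [X in (_ * X)%E](_ : _ = 1%E) ?mule1.
(* Subtracting from [M] gives nonnegative functions and turns upper limits into lower ones. *)
pose f n (u : borel X) : \bar R := (M - a n u)%:E.
have mf n : measurable_fun (L : set (borel X)) (f n).
  by apply/measurable_EFinP; apply: measurable_funB.
have f0 n u : L u -> (0 <= f n u)%E.
  by move=> /(aM n); rewrite lee_fin subr_ge0; exact: le_trans (ler_norm _).
have intf n : (\int[mu]_(u in (L : set (borel X))) f n u)%E = (M - v)%:E.
  rewrite /f; under eq_integral do rewrite EFinB.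
  rewrite integralB//; [|exact: intM|exact: inta].
  by rewrite invariant_integral_time_avg// intc.
pose g (u : borel X) : \bar R := limn_einf (f^~ u).
have mg : measurable_fun (L : set (borel X)) g.
  rewrite /g /limn_einf; apply: measurableT_comp => //.
  by apply: measurable_fun_limn_esup => k; apply: measurableT_comp.
have g_gt u : L u -> ((M - v)%:E < g u)%E.
  move=> Lu; have := lt_v u Lu; rewrite limsup_time_averageE limf_esupE.
  move=> /ereal_inf_lt[_ [V [T0 [_ TV]] <-]].
  set y := ereal_sup _ => yv.
  have avgy n : T0 < n.+1%:R -> ((a n u)%:E <= y)%E.
    by move=> /TV Vn; apply: ereal_sup_ubound; exists n.+1%:R.
  have near_n : \forall n \near \oo, T0 < n.+1%:R.
    near=> k; rewrite (@lt_trans _ _ k%:R) ?ltr_nat//.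
    by near: k; exact: nbhs_infty_gtr.
  have [n0 n0T] : exists n, T0 < n.+1%:R by near \oo => k; exists k; near: k.
  case: y yv avgy => [r|//|] yv avgy; last first.
    by have := avgy _ n0T; rewrite leeNy_eq.
  apply: (@lt_le_trans _ _ (M - r)%:E).
    by rewrite lte_fin ltrD2l ltrN2; move: yv; rewrite lte_fin.
  rewrite /g /limn_einf leeNr; apply: limf_esup_le; apply: filterS near_n => n /avgy.
  by rewrite !lee_fin => ar; rewrite lerN2 lerD2l lerN2.
have fat := @fatou _ _ _ mu (L : set (borel X)) mL f mf f0.
have gle : (\int[mu]_(u in (L : set (borel X))) g u <= (M - v)%:E)%E.
  apply: (le_trans fat); rewrite (_ : (fun n => _) = fun=> (M - v)%:E); last first.
    by apply/funext.
  rewrite /limn_einf leeNl; apply: le_limf_esup_cst.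
(* This difference is positive on [L] while its integral is at most 0, so it vanishes almost
   everywhere on a set of measure 1, a contradiction. *)
pose w u := (g u - (M - v)%:E)%E.
have w_gt0 u : L u -> (0 < w u)%E by move=> /g_gt; rewrite /w sube_gt0.
have mw : measurable_fun (L : set (borel X)) w.
  by apply: emeasurable_funB => //; exact: measurable_cst.
have vM : v <= M.
  rewrite -lee_fin -(invariant_integral_time_avg (T := 1))// -[leRHS]intc.
  apply: le_integral => //; [exact: (inta 0%N)|exact: intM|].
  move=> u; rewrite inE => Lu.
  by rewrite lee_fin (le_trans (ler_norm _))// time_avg_bound.
have intg : (\int[mu]_(u in (L : set (borel X))) g u =
    \int[mu]_(u in (L : set (borel X))) w u + (M - v)%:E)%E.
  transitivity (\int[mu]_(u in (L : set (borel X))) (w u + (M - v)%:E))%E.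
    by apply: eq_integral => u _; rewrite /w subeK.
  rewrite ge0_integralD//.
  - by rewrite intc.
  - by move=> u /w_gt0/ltW.
  - by move=> u _; rewrite lee_fin subr_ge0.
have w0 : (\int[mu]_(u in (L : set (borel X))) w u = 0)%E.
  apply/eqP; rewrite eq_le; apply/andP; split; last first.
    by apply: integral_ge0 => u /w_gt0/ltW.
  by move: gle; rewrite intg -leeBrDr// subee.
have : ae_eq mu (L : set (borel X)) w (cst 0%E).
  apply/ae_eq_integral_abs => //; rewrite -[RHS]w0; apply: eq_integral => u.
  by rewrite inE => Lu; rewrite gee0_abs// ltW// w_gt0.
move=> [N [mN N0 LN]].
have : (mu (L : set (borel X)) <= mu N)%E.
  apply: le_measure; rewrite ?inE// => u Lu; apply: LN => /= /(_ Lu) wu.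
  by have := w_gt0 u Lu; rewrite wu ltxx.
by rewrite [X in (X <= _)%E](_ : _ = 1%E)// N0 leNgt lte01.
Unshelve. all: by end_near. Qed.

End invariant_averages.

Theorem theorem5p1 (R : realType) (X : ptopologicalType)
    (W : completeNormedModType R) (iota F : X -> dual W) (S : R -> X -> X)
    (B K : set X) (phi : X -> R)
    (X_hausdorff : hausdorff_space X)
    (iota_inj : injective iota) (iota_cont : continuous iota)
    (F_borel : measurable_fun [set: borel X] (F : borel X -> borel (dual W)))
    (S_semigroup : continuous_semigroup S)
    (S_assoc : associated_semigroup iota F S)
    (B_neq0 : B !=set0) (B_invariant : positively_invariant S B)
    (B_closed : closed B) (B_normal : normal_space (set_type B))
    (K_compact : compact K) (K_metrizable : metrizable R (set_type K))
    (K_attracts : attracts_points S K B)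
    (F_cont : {within K, continuous F})
    (phi_cont : {within B, continuous phi})
    (phi_bounded : [bounded phi u | u in B]) :
  (forall Psi : cyl W,
     exists M : R, is_max [set lagrangian iota F phi Psi u | u in B `&` K] M) /\
  exists v : R,
    [/\ is_inf
          [set M : R | exists Psi : cyl W,
             is_max [set lagrangian iota F phi Psi u | u in B `&` K] M] v,
        is_max
          [set \int[mu]_(u in B `&` K) phi u
             | mu in P_wsss iota F (B `&` K)] v &
        P_wsss iota F (B `&` K) = P_inv S (B `&` K) ->
        is_max [set limsup_time_average S phi u0 | u0 in B] v%:E].
Proof.
have BK_cpt : compact (B `&` K) by exact: BK_compact.
have BK_closed : closed (B `&` K) by apply: closedI => //; exact: compact_closed.
have BK0 := BK_neq0 X_hausdorff S_semigroup B_neq0 B_invariant B_closed K_compact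
  K_attracts.
have [pi [pi_cont pi_range]] := compact_metrizable_cantor_image K_metrizable
  (@subIsetr _ B K) BK_cpt BK0.
have F_contL : {within B `&` K, continuous F}.
  exact: (continuous_subspaceW (@subIsetr _ B K)).
have phi_contL : {within B `&` K, continuous phi}.
  exact: (continuous_subspaceW (@subIsetl _ B K)).
have [u uL] := omega_trajectory X_hausdorff S_semigroup B_neq0 B_invariant B_closed
  K_compact K_attracts.
have no_descent (Psi : cyl W) (e : R) : 0 < e ->
    exists2 v, (B `&` K) v & - e < F v (cyl_deriv Psi (iota v)).
  by move=> e0; apply: (cyl_pairing_not_negative iota_cont S_assoc BK_cpt Psi uL).
have maxE Psi := lagrangian_max iota_cont BK_cpt F_contL phi_contL Psi BK0.
split => //.
pose A := [set M : R | exists Psi : cyl W,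
  is_max [set lagrangian iota F phi Psi u | u in B `&` K] M].
have [M phiM] : exists M, forall u, B u -> `|phi u| <= M.
  have [M [Mr MP]] := phi_bounded; exists (M + 1) => v Bv.
  by apply: MP => //; rewrite ltrDl.
have hA : has_inf A.
  split.
    have [Psi _] := cyl_zero F iota_cont BK_cpt.
    by have [m mmax] := maxE Psi; exists m, Psi.
  (* By [no_descent] with e = 1, the pairing exceeds -1 at some point of the set, where phi is at
     least - M. *)
  exists (- M - 1) => m [Psi [_ mub]].
  have [v Lv Gv] := no_descent Psi 1 ltr01.
  apply: (@le_trans _ _ (lagrangian iota F phi Psi v)); last by apply: mub; exists v.
  have := phiM v Lv.1; rewrite ler_norml /lagrangian => /andP[? _]; lra.
have infA : is_inf A (inf A).
  by split; [move=> a Aa; apply: ge_inf => //; case: hA|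
             move=> l lA; apply: lb_le_inf => //; case: hA].
have dual := lagrangian_duality iota_cont F_borel BK_closed BK_cpt F_contL phi_contL
  pi_cont pi_range no_descent infA.
exists (inf A); split => // wsss_inv.
have phiB : bounded_on B phi by exists M.
have upper u0 : B u0 -> (limsup_time_average S phi u0 <= (inf A)%:E)%E.
  move=> Bu0; have [mu mu_inv le_mu] := krylov_bogoliubov X_hausdorff S_semigroup
    B_invariant B_closed B_normal K_compact K_attracts pi_cont pi_range Bu0 phi_cont phiB.
  rewrite (le_trans le_mu)// lee_fin; apply: dual.2; exists mu => //.
  by rewrite wsss_inv.
split; last by move=> _ [u0 Bu0 <-]; exact: upper.
(* The maximizing stationary measure is invariant by assumption, and a point of its carrier reaches
   the bound [upper]. *)
have [[mu mu_wsss muA] _] := dual.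
have mu_inv : P_inv S (B `&` K) mu by rewrite -wsss_inv.
have [u1 Lu1 ge1] := invariant_limsup_ge S_semigroup B_invariant B_closed BK_closed
  (@subIsetl _ B K) mu_inv phi_cont phiM.
exists u1; first by case: Lu1.
apply/eqP; rewrite eq_le; apply/andP; split; first by apply: upper; case: Lu1.
by move: ge1; rewrite muA.
Qed.
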